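(* At least two of the 33 numbers $\zeta(5), \zeta(7), \zeta(9), \ldots, \zeta(69)$ (the values of the Riemann zeta function at the odd integers from $5$ to $69$) are irrational.
   Context: $\zeta(s)=\sum_{k\ge1}k^{-s}$ denotes the Riemann zeta function. *)

(* Defs.v *)
From mathcomp Require Import all_boot all_order all_algebra.
From mathcomp Require Import all_classical all_reals all_analysis.

Set Implicit Arguments.
Unset Strict Implicit.
Unset Printing Implicit Defensive.

Import Order.TTheory GRing.Theory Num.Theory.
Import numFieldNormedType.Exports.

Local Open Scope ring_scope.
Local Open Scope classical_set_scope.

(* Meaningful for 1 < s only: for s <= 1 the series diverges and the value is the
   arbitrary default of [limn]. *)
Definition zeta (R : realType) (s : R) : R :=
  limn (series (fun k : nat => k.+1%:R `^ (- s))).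

(* Main.v *)
(** Let R(t) = n!^70 / M * prod_(j <= 20n) (4t - 8n + j) / prod_(l <= n) (t + l)^70,
    where M is the n-smooth part of (20n)!.  Expanding R into partial fractions, the
    three sums S_d = sum_(q >= 1) R(q/d), d = 1, 2, 4, are rational plus
    sum_i d^i rho_i zeta(i) with the same rational rho_i, i <= 70.  The symmetry
    t -> -n - t kills rho_i for even i, and rho_1 = 0 because R decays fast enough.
    If all the zeta values in question except zeta(m) were rational, the combination
    S_4 - (8 + 2^m) S_2 + 2^(m+3) S_1, whose coefficients are those of
    (X - 8)(X - 2^m), would be free of both zeta(3) and zeta(m), hence rational.

    Its denominator divides a constant times L^70, where L is the n-smooth part of
    lcm(1, ..., 20n).  It is positive, since R(a + 1/2) <= R(a) + R(a + 1) bounds the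
    half-integral terms by the integral ones.  It is small, since R(t) t^2 decreases
    shortly after t = 2n, which leaves the elementary estimate of R near 2n.

    Finally, L^70 (20n)! / M is bounded by a factorial ratio: as in Chebyshev's
    estimates, the exponent of a prime p in prod_m (x/m)!^(c_m), x = 20n, is essentially
    sum_m c_m floor(x/(m p)), and the c_m are chosen so as to make it large enough.
    The remaining numerical inequality between exponential growth rates has a margin
    of a factor e^29 per unit of y = n/42. *)
Require Import Defs.
From HB Require Import structures.
From mathcomp Require Import all_boot all_order all_algebra.
From mathcomp Require Import all_classical all_reals all_analysis.
From mathcomp Require Import zify ring lra.

Set Implicit Arguments.
Unset Strict Implicit.
Unset Printing Implicit Defensive.

Import Order.TTheory GRing.Theory Num.Theory.
Import numFieldNormedType.Exports.

Local Open Scope nat_scope.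

(** * Denominators: primes and factorials *)

Lemma logn_prod (I : Type) (r : seq I) (P : pred I) (F : I -> nat) (p : nat) :
  (forall i, P i -> 0 < F i) ->
  logn p (\prod_(i <- r | P i) F i) = \sum_(i <- r | P i) logn p (F i).
Proof.
move=> F_gt0; suff [] : 0 < \prod_(i <- r | P i) F i /\
  logn p (\prod_(i <- r | P i) F i) = \sum_(i <- r | P i) logn p (F i) by [].
elim/big_ind2: _ => [|m x n y [m_gt0 <-] [n_gt0 <-]|i Pi].
- by rewrite logn1.
- by rewrite muln_gt0 m_gt0 n_gt0 lognM.
- by split => //; apply: F_gt0.
Qed.

Lemma leq_expl e m n : m <= n -> m ^ e <= n ^ e.
Proof. by case: e => // e; rewrite leq_exp2r. Qed.

Lemma dvdn_from_logn m n : 0 < m -> 0 < n ->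
  (forall p, prime p -> logn p m <= logn p n) -> m %| n.
Proof.
move=> m_gt0 n_gt0 le_mn.
have -> : m = gcdn m n.
  apply: eqn_from_log => //; first by rewrite gcdn_gt0 m_gt0.
  move=> p; rewrite logn_gcd //; apply/esym/minn_idPl.
  by have [/le_mn //|np] := boolP (prime p); rewrite lognE (negbTE np).
exact: dvdn_gcdr.
Qed.

Lemma logn_partn (pi : nat_pred) p n : prime p -> 0 < n ->
  logn p n`_pi = if p \in pi then logn p n else 0.
Proof.
move=> p_pr n_gt0.
case: ifPn => ppi; last first.
  apply: logn_coprime; rewrite prime_coprime //; apply: contra ppi.
  exact: (pnatP _ (part_gt0 _ _) (part_pnat pi n)).
rewrite -{2}(partnC pi n_gt0) lognM ?part_gt0 // [X in _ + X]logn_coprime ?addn0 //.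
rewrite prime_coprime //; apply/negP.
by move=> /(pnatP _ (part_gt0 _ _) (part_pnat pi^' n) _ p_pr); rewrite !inE /= ppi.
Qed.

Lemma logn_fact_wide p m n : prime p -> m <= n ->
  logn p m`! = \sum_(1 <= k < n.+1) m %/ p ^ k.
Proof.
move=> p_pr le_mn; rewrite logn_fact //.
rewrite [RHS](big_cat_nat_idem _ (n := m.+1)) //=.
rewrite [X in _ = _ + X]big1_seq ?addn0 // => k /andP[_].
rewrite mem_index_iota => /andP[lt_mk _]; apply: divn_small.
by apply: leq_trans (ltn_expl k (prime_gt1 p_pr)); lia.
Qed.

(** * Chebyshev's bound for the primorial *)

Definition primorial n := \prod_(p < n.+1 | prime p) p.

Lemma primorial_gt0 n : 0 < primorial n.
Proof. by rewrite prodn_cond_gt0 // => p /prime_gt0. Qed.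

Lemma logn_primorial p n : prime p -> logn p (primorial n) = (p <= n).
Proof.
move=> p_pr; rewrite /primorial logn_prod; last by move=> i /prime_gt0.
under eq_bigr => i i_pr do rewrite logn_prime //.
case: leqP => [le_pn|lt_np].
  rewrite (bigD1 (Ordinal (le_pn : p < n.+1))) //= eqxx big1 // => i.
  by case/andP=> _; rewrite -val_eqE /= eq_sym => /negbTE ->.
rewrite big1 // => i _; case: eqP => // Ep.
by have := ltn_ord i; rewrite -Ep ltnS leqNgt lt_np.
Qed.

Lemma primorialS n : primorial n.+1 = (if prime n.+1 then n.+1 else 1) * primorial n.
Proof.
rewrite /primorial big_mkcond big_ord_recr /= -big_mkcond /= mulnC.
by congr (_ * _); apply: eq_bigl.
Qed.

(** The coefficients at m and m + 1 are equal, and row 2m + 1 sums to 2 * 4^m. *)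
Lemma bin_odd_central_le m : 'C(m.*2.+1, m) <= 4 ^ m.
Proof.
have : \sum_(i < m.*2.+2) 'C(m.*2.+1, i) = 2 ^ m.*2.+1.
  by rewrite -[RHS]/((1 + 1) ^ _) expnDn; apply: eq_bigr => i _; rewrite !exp1n !muln1.
have mlt : m < m.*2.+2 by lia.
have m1lt : m.+1 < m.*2.+2 by lia.
rewrite (bigD1 (Ordinal mlt)) //= (bigD1 (Ordinal m1lt)) /=; last first.
  by rewrite -val_eqE /=; lia.
have -> : 'C(m.*2.+1, m.+1) = 'C(m.*2.+1, m).
  by rewrite -bin_sub; [congr 'C(_, _); lia|lia].
have -> : 2 ^ m.*2.+1 = 2 * 4 ^ m by rewrite expnS -mul2n expnM.
by move: (\sum_(_ < _ | _) _) => S; lia.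
Qed.

(** A prime p with m + 1 < p <= 2m + 1 divides (2m + 1)! but neither m! nor (m + 1)!. *)
Lemma primorial_odd_dvd m :
  primorial m.*2.+1 %| 'C(m.*2.+1, m) * primorial m.+1.
Proof.
apply: dvdn_from_logn; rewrite ?muln_gt0 ?primorial_gt0 ?bin_gt0 ?andbT //; first by lia.
move=> p p_pr; rewrite lognM ?primorial_gt0 ?bin_gt0 //; last by lia.
rewrite !logn_primorial //; case: (leqP p m.+1) => lpm; first by rewrite addn1 (leq_trans (leq_b1 _)).
case: (leqP p m.*2.+1) => // lpm2; rewrite addn0.
have fact_small k : k < p -> logn p k`! = 0.
  move=> lt_kp; rewrite logn_fact // big1_seq // => i /andP[_].
  rewrite mem_index_iota => /andP[i_gt0 _]; apply: divn_small.
  by apply: leq_trans lt_kp _; rewrite -{1}(expn1 p) leq_exp2l ?prime_gt1.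
have le_m : m <= m.*2.+1 by lia.
have : p ^ 1 %| (m.*2.+1)`! by rewrite expn1 dvdn_fact ?prime_gt0.
rewrite pfactor_dvdn ?fact_gt0 // -(bin_fact le_m).
rewrite (lognM p (n := _ * _)) ?muln_gt0 ?fact_gt0 ?bin_gt0 // lognM ?fact_gt0 //.
by rewrite (fact_small m) ?(fact_small (_ - _)) ?addn0 //; lia.
Qed.

(** Induction of Erdos: an even n > 2 adds no prime, and an odd n = 2m + 1 is reduced to m + 1 at
    the cost of a binomial coefficient. *)
Lemma primorial_le n : primorial n <= 4 ^ n.
Proof.
elim/ltn_ind: n => n IH.
have [n_odd|n_even] := boolP (odd n); last first.
  case: n IH n_even => [|[|n]] IH //; first by rewrite /primorial big_mkcond /= big_ord_recl big_ord0.
  case: n IH => [|n] IH n_even.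
    by rewrite /primorial big_mkcond /= !big_ord_recr big_ord0.
  rewrite primorialS; case: ifP => [/even_prime|_]; first by case=> //; rewrite (negbTE n_even).
  rewrite mul1n; by apply: leq_trans (IH n.+2 _) _; rewrite ?leq_exp2l.
have Dn : n = n./2.*2.+1 by rewrite -[LHS]odd_double_half n_odd.
have [m0|m_gt0] := posnP n./2.
  by rewrite Dn m0 /primorial big_mkcond /= !big_ord_recr big_ord0.
rewrite {1}Dn.
have := dvdn_leq _ (primorial_odd_dvd n./2).
rewrite muln_gt0 primorial_gt0 bin_gt0 (_ : _ <= _) //; last by lia.
move=> /(_ isT) /leq_trans; apply.
apply: leq_trans (leq_mul (bin_odd_central_le _) (IH _ _)) _; first lia.
by rewrite -expnD leq_exp2l //; lia.
Qed.

(** * Smooth parts of factorials and of the least common multiple *)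

Definition smooth n : nat_pred := [pred p | p <= n].

Lemma mem_smooth n p : (p \in smooth n) = (p <= n).
Proof. by []. Qed.

(* The n-smooth part of lcm(1, ..., N). *)
Definition slcm n N := \prod_(0 <= p < n.+1 | prime p) p ^ trunc_log p N.

Lemma slcm_gt0 n N : 0 < slcm n N.
Proof. by rewrite prodn_cond_gt0 // => p p_pr; rewrite expn_gt0 prime_gt0. Qed.

Lemma logn_prod_primes (a b : nat) (f : nat -> nat) p : prime p ->
  logn p (\prod_(a <= r < b | prime r) r ^ f r) = if a <= p < b then f p else 0.
Proof.
move=> p_pr; rewrite logn_prod; last by move=> r r_pr; rewrite expn_gt0 prime_gt0.
under eq_bigr => r r_pr do rewrite lognX logn_prime // [p == r]eq_sym.
rewrite -mem_index_iota; case: ifPn => [pab|npab].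
  rewrite big_mkcond (bigD1_seq p) ?iota_uniq //= p_pr eqxx muln1 big1 ?addn0 // => r.
  by move/negbTE->; rewrite muln0 if_same.
rewrite big1_seq // => r /andP[_ rab]; case: eqP => [Er|]; last by rewrite muln0.
by rewrite -Er rab in npab.
Qed.

Lemma logn_slcm p n N : prime p ->
  logn p (slcm n N) = if p <= n then trunc_log p N else 0.
Proof. by move=> p_pr; rewrite logn_prod_primes // ltnS. Qed.

Lemma part_dvd_slcm a n N : 0 < a <= N -> a`_(smooth n) %| slcm n N.
Proof.
case/andP=> a_gt0 le_aN; apply: dvdn_from_logn; rewrite ?part_gt0 ?slcm_gt0 //.
move=> p p_pr; rewrite logn_partn // logn_slcm // mem_smooth; case: ifP => // _.
apply: trunc_log_max; first exact: prime_gt1.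
by apply: leq_trans le_aN; apply: dvdn_leq => //; apply: pfactor_dvdnn.
Qed.

(** By Legendre's formula each power p^k adds at most 1 to the valuation of the binomial
    coefficient, and nothing once p^k > u + w. This later cancels the smooth part of (20n)! in the
    denominator of [rat_cst]. *)
Lemma fact_part_dvd n u w :
  (u + w)`!`_(smooth n) %| slcm n (u + w) * (u`! * w`!)`_(smooth n).
Proof.
apply: dvdn_from_logn; rewrite ?muln_gt0 ?part_gt0 ?slcm_gt0 //.
move=> p p_pr; rewrite lognM ?slcm_gt0 ?part_gt0 //.
rewrite !logn_partn ?muln_gt0 ?fact_gt0 // logn_slcm // mem_smooth; case: ifP => // _.
rewrite lognM ?fact_gt0 // !(logn_fact_wide p_pr (n := u + w)) ?leq_addr ?leq_addl //.
set t := trunc_log p (u + w).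
have Dt : \sum_(1 <= k < (u + w).+1) (k <= t) <= t.
  rewrite -big_mkcond /= sum1_count.
  have /uniq_leq_size : uniq [seq k <- index_iota 1 (u + w).+1 | k <= t].
    by rewrite filter_uniq ?iota_uniq.
  move/(_ (iota 1 t)); rewrite size_filter size_iota; apply=> k.
  by rewrite mem_filter mem_index_iota mem_iota; lia.
apply: leq_trans (leq_add Dt (leqnn _)); rewrite -!big_split /=.
apply: leq_sum => k _; have [_|lt_tk] := leqP k t.
  by rewrite divnD ?expn_gt0 ?prime_gt0 // addnC leq_add // leq_b1.
by rewrite divn_small // (leq_trans (trunc_log_ltn _ (prime_gt1 p_pr))) ?leq_exp2l ?prime_gt1.
Qed.

(** * The factorial ratio certificate *)

(* Exponents of a factorial ratio in the style of Chebyshev, found by linear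
   programming: a pair (m, c) stands for the c-th power of (x / m)!. *)
Definition cert_num : seq (nat * nat) := [:: (1, 1); (20, 50); (120, 11); (168, 11)].
Definition cert_den : seq (nat * nat) :=
  [:: (24, 4); (30, 6); (35, 5); (40, 53); (42, 4); (56, 10); (60, 48); (84, 8);
      (105, 11); (140, 61); (840, 95)].

Definition floor_sum (c : seq (nat * nat)) N := sumn [seq mc.2 * (N %/ mc.1) | mc <- c].

Definition fact_prod_of (c : seq (nat * nat)) x := \prod_(mc <- c) (x %/ mc.1)`! ^ mc.2.

Lemma fact_prod_of_gt0 c x : 0 < fact_prod_of c x.
Proof. by rewrite prodn_gt0 // => i; rewrite expn_gt0 fact_gt0. Qed.

Lemma logn_fact_prod_of p c x : prime p ->
  logn p (fact_prod_of c x) = \sum_(1 <= k < x.+1) floor_sum c (x %/ p ^ k).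
Proof.
move=> p_pr; rewrite logn_prod; last by move=> i _; rewrite expn_gt0 fact_gt0.
rewrite /floor_sum; under [RHS]eq_bigr do rewrite sumnE big_map.
rewrite exchange_big /=; apply: eq_bigr => mc _.
rewrite lognX (logn_fact_wide p_pr (leq_div _ _)) big_distrr /=.
by apply: eq_bigr => k _; rewrite -!divnMA [mc.1 * _]mulnC.
Qed.

Lemma floor_sumD c r k : all (fun mc => (0 < mc.1) && (mc.1 %| 840)) c ->
  floor_sum c (r + k * 840) = floor_sum c r + k * floor_sum c 840.
Proof.
rewrite /floor_sum !sumnE !big_map => /allP c_ok.
rewrite big_distrr -big_split /= big_seq [RHS]big_seq; apply: eq_bigr => mc /c_ok.
case/andP=> m_gt0 /dvdnP[z Ez]; rewrite Ez mulnK //.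
by rewrite [r + _]addnC mulnA divnMDl //; ring.
Qed.

Lemma all_iotaP (P : pred nat) n : all P (iota 0 n) -> forall r, r < n -> P r.
Proof. by move=> /allP allPn r lt_rn; apply: allPn; rewrite mem_iota. Qed.

Definition cert_at N :=
  floor_sum cert_den N + (if N < 20 then N else 70) <= floor_sum cert_num N.

Lemma cert_at_small r : r < 840 -> cert_at r.
Proof. by move: r; apply: all_iotaP; vm_compute. Qed.

(** The sums of c / m over the two certificates agree: both floor sums grow by 3072 over 840 steps.
    Their difference therefore has period 840, and a finite check suffices. *)
Lemma floor_sum_period k r :
  exists s, (floor_sum cert_den (r + k * 840) = floor_sum cert_den r + s) /\
            (floor_sum cert_num (r + k * 840) = floor_sum cert_num r + s).
Proof.
by exists (k * floor_sum cert_num 840); rewrite !floor_sumD.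
Qed.

(* With x = 840 y and N = x %/ p, the second summand is the exponent to which a prime
   p > sqrt x has to be cleared: 70 if p <= n = x / 20, and that of p in x`! otherwise.
   The defect for 840 <= N, that is p <= y, is left to the primorial of y. *)
Lemma cert_ok N :
  floor_sum cert_den N + (if N < 20 then N else 70) <=
  floor_sum cert_num N + 70 * (840 <= N).
Proof.
have r_lt : N %% 840 < 840 by apply: ltn_pmod.
have := cert_at_small r_lt; rewrite /cert_at.
have [s] := floor_sum_period (N %/ 840) (N %% 840).
rewrite addnC -divn_eq => -[-> ->].
have [lt_N|le_N] := ltnP N 840.
  by rewrite modn_small //; move: (floor_sum _ _) (floor_sum _ _) => a b; lia.
have -> : N < 20 = false by lia.
by move: (floor_sum _ _) (floor_sum _ _) (if _ then _ else _) => a b c; lia.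
Qed.

Lemma cert_ge0 N : floor_sum cert_den N <= floor_sum cert_num N.
Proof.
have := cert_ok N; have [le_N|lt_N] := leqP 840 N; last first.
  by move: (floor_sum _ _) (floor_sum _ _) => a b; lia.
have -> : (if N < 20 then N else 70) = 70 by case: ltnP => //; lia.
by rewrite muln1; move: (floor_sum _ _) (floor_sum _ _) => a b; lia.
Qed.

(** Primes up to q cost at most x each; a prime above q has p^2 > x and enters only once. *)
Lemma slcm_le n x q : 0 < x -> x < q.+1 ^ 2 -> q <= n ->
  slcm n x <= x ^ q.+1 * \prod_(q.+1 <= p < n.+1 | prime p) p.
Proof.
move=> x_gt0 lt_xq le_qn; rewrite /slcm (big_cat_nat _ (n := q.+1)) //=.
apply: leq_mul.
  rewrite -[X in _ <= x ^ X]subn0 -prod_nat_const_nat big_mkcond /=.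
  apply: leq_prod => p _; case: ifP => // p_pr.
  by rewrite trunc_logP ?prime_gt1.
rewrite big_mkcond [X in _ <= X]big_mkcond /= big_seq [X in _ <= X]big_seq.
apply: leq_prod => p; rewrite mem_index_iota => /andP[lt_qp _]; case: ifP => // p_pr.
suff t_le1 : trunc_log p x <= 1 by rewrite -[X in _ <= X]expn1 leq_exp2l ?prime_gt1.
rewrite -ltnS -(ltn_exp2l _ _ (prime_gt1 p_pr)).
apply: leq_ltn_trans (trunc_logP (prime_gt1 p_pr) x_gt0) _.
by apply: leq_trans lt_xq _; rewrite leq_exp2r.
Qed.

(** Valuations are compared prime by prime. The powers of primes p <= q in [slcm] go into the crude
    factor x^(70(q + 1)); for p > q only N = x %/ p matters and [cert_ok] applies. Its defect 70 for
    p <= y is paid by the 70th power of the primorial of y. *)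
Lemma multiplier_bound (y q : nat) : 0 < y -> 840 * y < q.+1 ^ 2 -> q <= 42 * y ->
  (slcm (42 * y) (840 * y)) ^ 70 * (840 * y)`!`_(smooth (42 * y))^' *
    fact_prod_of cert_den (840 * y) <=
  (840 * y) ^ (70 * q.+1) * (fact_prod_of cert_num (840 * y) * 4 ^ (70 * y)).
Proof.
move=> y_gt0 lt_xq le_qn; set x := 840 * y; set n := 42 * y.
have x_gt0 : 0 < x by rewrite muln_gt0.
set T := \prod_(q.+1 <= p < n.+1 | prime p) p.
have T_gt0 : 0 < T by rewrite prodn_cond_gt0 // => p /prime_gt0.
have le_slcm : slcm n x ^ 70 <= x ^ (70 * q.+1) * T ^ 70.
  by rewrite [70 * _]mulnC expnM -expnMn leq_exp2r // slcm_le.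
rewrite -mulnA; apply: leq_trans (leq_mul le_slcm (leqnn _)) _.
rewrite -mulnA leq_pmul2l ?expn_gt0 ?x_gt0 //.
apply: (@leq_trans (fact_prod_of cert_num x * primorial y ^ 70)); last first.
  by rewrite leq_mul // [70 * y]mulnC expnM leq_exp2r // primorial_le.
have T70_gt0 : 0 < T ^ 70 by rewrite expn_gt0 T_gt0.
have P70_gt0 : 0 < primorial y ^ 70 by rewrite expn_gt0 primorial_gt0.
apply: dvdn_leq; first by rewrite muln_gt0 fact_prod_of_gt0 P70_gt0.
apply: dvdn_from_logn => [||p p_pr].
- by rewrite muln_gt0 T70_gt0 muln_gt0 part_gt0 fact_prod_of_gt0.
- by rewrite muln_gt0 fact_prod_of_gt0 P70_gt0.
rewrite (lognM p T70_gt0) ?muln_gt0 ?part_gt0 ?fact_prod_of_gt0 //.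
rewrite (lognM p (part_gt0 _ _)) ?fact_prod_of_gt0 //.
rewrite (lognM p (fact_prod_of_gt0 _ _)) //.
rewrite !lognX logn_primorial // !logn_fact_prod_of // logn_partn ?fact_gt0 //.
have -> : logn p T = (q < p <= n).
  have -> : T = \prod_(q.+1 <= r < n.+1 | prime r) r ^ 1.
    by apply: eq_bigr => r _; rewrite expn1.
  by rewrite (logn_prod_primes _ _ (fun=> 1)) // ltnS; case: ifP.
have -> : (p \in (smooth n)^') = (n < p) by rewrite inE /= mem_smooth ltnNge.
(* A prime p <= q divides neither T nor the non-smooth part, so [cert_ge0] settles it. *)
have [le_pq|lt_qp] := leqP p q.
  have -> : n < p = false by lia.
  rewrite !muln0 !add0n; apply: leq_trans (leq_addr _ _).
  by apply: leq_sum => k _; apply: cert_ge0.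
(* For p > q the square of p exceeds x, so only k = 1 survives in Legendre's formula. *)
have big1st (F : nat -> nat) : F 0 = 0 ->
    \sum_(1 <= k < x.+1) F (x %/ p ^ k) = F (x %/ p).
  move=> F0; rewrite big_ltn // expn1 big1_seq ?addn0 // => k.
  rewrite mem_index_iota => /andP[_ /andP[k_gt1 _]]; rewrite divn_small ?F0 //.
  apply: leq_trans lt_xq _; apply: leq_trans (_ : p ^ 2 <= _).
    by rewrite leq_exp2r.
  by rewrite leq_pexp2l ?prime_gt0.
rewrite (logn_fact_wide p_pr (leqnn _)) (big1st id) // !(big1st (floor_sum _)) //.
have := cert_ok (x %/ p).
have -> : (840 <= x %/ p) = (p <= y) by rewrite leq_divRL ?prime_gt0 // leq_pmul2l.
have -> : (x %/ p < 20) = (n < p).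
  by rewrite ltn_divLR ?prime_gt0 // /x /n -[840]/(20 * 42) -mulnA ltn_pmul2l.
move: (floor_sum _ _) (floor_sum _ _) => a b.
by rewrite leqNgt; case: (ltnP n p) => _ /=; rewrite ?muln0 ?muln1; lia.
Qed.

(** * Exponential growth of factorial ratios *)

Lemma fact_add_le a z : (a + z)`! <= a`! * (a + z) ^ z.
Proof.
elim: z => [|z IH]; first by rewrite addn0 muln1.
rewrite addnS factS expnS mulnCA leq_mul2l /=; apply: leq_trans IH _.
by rewrite leq_mul2l leq_expl ?orbT //; lia.
Qed.

Lemma fact_add_ge a z : a`! * a ^ z <= (a + z)`!.
Proof.
elim: z => [|z IH]; first by rewrite addn0 muln1.
rewrite addnS factS expnS mulnCA leq_mul //.
by rewrite leqW ?leq_addr.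
Qed.

(** An elementary replacement for Stirling's formula: together with [fact_mul_ge] it gives (z y)! as
    z^(z y) y!^z up to a factor (z y)^z, polynomial in y. *)
Lemma fact_mul_le z y : (z * y)`! <= z ^ (z * y) * y`! ^ z.
Proof.
elim: y => [|y IH]; first by rewrite muln0 exp1n.
rewrite mulnS addnC; apply: leq_trans (fact_add_le _ _) _.
apply: leq_trans (leq_mul IH (leqnn _)) _.
by rewrite factS expnD expnMn addnC -mulnS expnMn; apply/eq_leq; ring.
Qed.

Lemma fact_mul_ge z y : 0 < y -> z ^ (z * y) * y`! ^ z <= (z * y)`! * (z * y) ^ z.
Proof.
elim: y => // -[|y] IH _.
  by rewrite !muln1 exp1n muln1 leq_pmull ?fact_gt0.
have := leq_mul (IH isT) (leqnn ((z * y.+2) ^ z)).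
rewrite [z * y.+2]mulnS [z + _]addnC => H.
apply: leq_trans (leq_trans H (leq_mul (fact_add_ge _ _) (leqnn _))).
rewrite [y.+2`!]factS expnD addnC -mulnS !expnMn.
by apply/eq_leq; ring.
Qed.

(** A pair (z, c) stands for (z y)!^c. Up to factors polynomial in y the product is [base_list] ^ y
    times y! ^ [weight], so equal weights leave only exponential rates to compare. *)
Definition fact_list (l : seq (nat * nat)) y := \prod_(zc <- l) (zc.1 * y)`! ^ zc.2.
Definition base_list (l : seq (nat * nat)) := \prod_(zc <- l) zc.1 ^ (zc.1 * zc.2).
Definition weight (l : seq (nat * nat)) := sumn [seq zc.1 * zc.2 | zc <- l].

Lemma fact_list_le l y : fact_list l y <= base_list l ^ y * y`! ^ weight l.
Proof.
rewrite /fact_list /base_list /weight; elim: l => [|[z c] l IH] /=.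
  by rewrite !big_nil exp1n.
rewrite !big_cons /=; apply: leq_trans (leq_mul _ IH) _.
  by apply: (leq_trans (n := (z ^ (z * y) * y`! ^ z) ^ c)); last exact: leqnn;
     rewrite leq_expl ?fact_mul_le.
rewrite !expnMn !expnD -!expnM [z * c * y]mulnAC.
by apply/eq_leq; ring.
Qed.

Lemma fact_list_ge l y b : 0 < y -> all (fun zc => zc.1 <= b) l ->
  base_list l ^ y * y`! ^ weight l <= fact_list l y * (b * y) ^ weight l.
Proof.
rewrite /fact_list /base_list /weight => y_gt0; elim: l => [|[z c] l IH] /=.
  by rewrite !big_nil exp1n.
case/andP=> le_zb /IH {}IH; rewrite !big_cons /=.
have head : (z ^ (z * y) * y`! ^ z) ^ c <= (z * y)`! ^ c * (b * y) ^ (z * c).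
  rewrite [(b * y) ^ _]expnM -expnMn leq_expl // (leq_trans (fact_mul_ge _ _)) //.
  by rewrite leq_mul2l leq_expl ?orbT // leq_mul2r le_zb orbT.
apply: leq_trans (leq_trans (leq_mul head IH) _).
  rewrite !expnMn !expnD -!expnM [z * c * y]mulnAC.
  by apply/eq_leq; ring.
by rewrite expnD; apply/eq_leq; ring.
Qed.

Definition prime_weight p (l : seq (nat * nat)) :=
  sumn [seq zc.1 * zc.2 * logn p zc.1 | zc <- l].

(** The rates are far too large to evaluate as unary numbers, so only their prime exponents are
    computed. *)
Lemma base_listE (ps : seq nat) l :
  all (fun zc => zc.1 == foldr muln 1 [seq p ^ logn p zc.1 | p <- ps]) l ->
  base_list l = foldr muln 1 [seq p ^ prime_weight p l | p <- ps].
Proof.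
rewrite foldrE big_map /base_list /prime_weight; elim: l => [|[z c] l IH] /=.
  by rewrite big_nil big1.
rewrite foldrE big_map => /andP[/eqP Ez /IH {}IH]; rewrite big_cons IH /=.
rewrite {1}Ez (big_morph (expn^~ _) (fun m n => expnMn m n _) (exp1n _)) -big_split /=.
by apply: eq_bigr => p _; rewrite expnD -expnM [logn p z * _]mulnC.
Qed.

(** The entries (840 / m, c) translate the certificate to x = 840 y. The others are the factorials
    of [peak] for n = 42 y without the shifts 4 and 3, and (840 y)!, which unites the smooth part in
    [rat_cst] with its complement in [multiplier_bound]. *)
Definition numerator_list :=
  [seq (840 %/ mc.1, mc.2) | mc <- cert_num] ++ [:: (42, 70); (84, 70); (842, 1)].
Definition denominator_list :=
  [seq (840 %/ mc.1, mc.2) | mc <- cert_den] ++ [:: (840, 1); (2, 1); (126, 70)].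

Lemma leq_exp_combine a b p q r s m : a ^ p <= b ^ q -> a ^ r <= b ^ s ->
  a ^ (p * m + r) <= b ^ (q * m + s).
Proof. by move=> le1 le2; rewrite !expnD !expnM leq_mul ?leq_expl. Qed.

Lemma leq_pow2_combine a b c d e f : a + b + c + d <= e + f ->
  2 ^ a * 2 ^ b * 2 ^ c * 2 ^ d <= 2 ^ e * 2 ^ f.
Proof. by move=> le_ef; rewrite -!expnD leq_exp2l. Qed.

(** Logarithms are replaced by rational bounds: log_2 3 >= 84/53, log_2 5 >= 65/28, log_2 7 <=
    73/26, log_2 421 <= 340/39. Each exponent is split into a multiple of the denominator and a
    remainder, so that only small powers are compared numerically. *)
Lemma certificate_arith n2 n3 n5 d2 d7 :
  n2 = d2 + 6 * 1097 ->
  2 ^ 172 * (2 ^ n2 * (3 ^ n3 * (5 ^ n5 * (7 ^ (d7 + (26 * 3 + 6)) * (421 ^ (39 * 21 + 23) * 1))))) <=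
  2 ^ d2 * (3 ^ (n3 + (53 * 159 + 42)) * (5 ^ (n5 + (28 * 14 + 3)) * (7 ^ d7 * 1))).
Proof.
move=> ->.
have pow3 : 2 ^ (84 * 159 + 66) <= 3 ^ (53 * 159 + 42).
  by apply: leq_exp_combine; clear; lia.
have pow5 : 2 ^ (65 * 14 + 6) <= 5 ^ (28 * 14 + 3).
  by apply: leq_exp_combine; clear; lia.
have pow7 : 7 ^ (26 * 3 + 6) <= 2 ^ (73 * 3 + 17).
  by apply: leq_exp_combine; clear; lia.
have pow421 : 421 ^ (39 * 21 + 23) <= 2 ^ (340 * 21 + 201).
  by apply: leq_exp_combine; clear; lia.
have pow2 : 2 ^ 172 * 2 ^ (6 * 1097) * 2 ^ (73 * 3 + 17) * 2 ^ (340 * 21 + 201) <=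
            2 ^ (84 * 159 + 66) * 2 ^ (65 * 14 + 6).
  by apply: leq_pow2_combine; clear; lia.
rewrite (expnD 2 d2) (expnD 3 n3) (expnD 5 n5) (expnD 7 d7).
move: (2 ^ 172) (2 ^ (6 * 1097)) (2 ^ (73 * 3 + 17)) (2 ^ (340 * 21 + 201))
  (2 ^ (84 * 159 + 66)) (2 ^ (65 * 14 + 6)) (3 ^ (53 * 159 + 42)) (5 ^ (28 * 14 + 3))
  (7 ^ (26 * 3 + 6)) (421 ^ (39 * 21 + 23)) pow3 pow5 pow7 pow421 pow2.
move=> a b c d e f t3 t5 t7 t421 pow3 pow5 pow7 pow421 pow2.
have H := leq_trans (leq_mul (leq_mul (leqnn (a * b)) pow7) pow421)
  (leq_trans pow2 (leq_mul pow3 pow5)).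
have := leq_mul (leqnn (2 ^ d2 * 3 ^ n3 * 5 ^ n5 * 7 ^ d7)) H.
move: (2 ^ d2) (3 ^ n3) (5 ^ n5) (7 ^ d7) => u v w x H'.
apply: leq_trans (leq_trans H' _); apply: eq_leq; by ring.
Qed.

(** Of the margin 2^172, a factor 4^70 = 2^140 pays for the primorial and 2^32 is left for
    subexponential losses. The prime 421 enters through 842. *)
Lemma certificate_base_lt :
  2 ^ 172 * base_list numerator_list <= base_list denominator_list.
Proof.
have -> := @base_listE [:: 2; 3; 5; 7; 421] numerator_list ltac:(by vm_compute).
have -> := @base_listE [:: 2; 3; 5; 7] denominator_list ltac:(by vm_compute).
have E421 : prime_weight 421 numerator_list = 39 * 21 + 23 by vm_compute.
have E3 : prime_weight 3 denominator_list =
  prime_weight 3 numerator_list + (53 * 159 + 42) by vm_compute.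
have E5 : prime_weight 5 denominator_list =
  prime_weight 5 numerator_list + (28 * 14 + 3) by vm_compute.
have E7 : prime_weight 7 numerator_list =
  prime_weight 7 denominator_list + (26 * 3 + 6) by vm_compute.
have E2 : prime_weight 2 numerator_list =
  prime_weight 2 denominator_list + 6 * 1097 by vm_compute.
cbn [map foldr]; rewrite E421 E3 E5 E7.
exact: certificate_arith.
Qed.

Lemma weight_lists : weight numerator_list = weight denominator_list.
Proof. by vm_compute. Qed.

Lemma fact_list_cat l1 l2 y : fact_list (l1 ++ l2) y = fact_list l1 y * fact_list l2 y.
Proof. exact: big_cat. Qed.

Lemma fact_prod_of_list c y : all (fun mc => (0 < mc.1) && (mc.1 %| 840)) c ->
  fact_prod_of c (840 * y) = fact_list [seq (840 %/ mc.1, mc.2) | mc <- c] y.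
Proof.
move=> /allP c_ok; rewrite /fact_list big_map /fact_prod_of big_seq [RHS]big_seq.
by apply: eq_bigr => mc /c_ok /andP[_ dv]; rewrite divn_mulAC.
Qed.

Lemma factorial_ratio_bound y : 0 < y ->
  2 ^ (172 * y) * fact_list numerator_list y <=
  fact_list denominator_list y * (842 * y) ^ weight denominator_list.
Proof.
move=> y_gt0; apply: leq_trans (leq_mul (leqnn _) (fact_list_le _ _)) _.
rewrite expnM mulnA -expnMn weight_lists.
apply: leq_trans (fact_list_ge y_gt0 (_ : all (fun zc => zc.1 <= 842) _)); last first.
  by vm_compute.
by rewrite leq_mul // leq_expl // certificate_base_lt.
Qed.

(** * Choice of the parameter y *)

Lemma sqr_pow2_le a c k : a <= (2 ^ c) ^ 2 -> a * (2 ^ k) ^ 2 <= 2 ^ (2 * (k + c)).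
Proof. by move=> le_a; rewrite mulnC [2 * _]mulnC expnM expnD expnMn leq_mul2l le_a orbT. Qed.

(** With q near sqrt x, the factor x^(70(q + 1)) is exp(O(sqrt y log y)), far below 2^(32 y). For y
    = 840 u^2, u = 2^k, the square root of 840 y is the integer 840 u, and logarithms become linear
    in k. *)
Lemma pow2_dominates D S K : exists k, K <= k /\
  D * (846 * (840 * (2 ^ k) ^ 2)) ^ (6 + 70 * (840 * 2 ^ k).+1 + S) <
  2 ^ (32 * (840 * (2 ^ k) ^ 2)).
Proof.
have growth j : 5 * (j + 7 + 10) <= 2 ^ (j + 7).
  elim: j => [|j IH]; first by [].
  by rewrite !addSn expnS; lia.
(* The terms D, S + 76 and K make the exponent dominate the constants, and 7 starts the induction
   [growth]. Its factor 5 is enough since 2 * 70 / 5 = 28 < 32. *)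
exists (D + S + 76 + K + 7); split; first lia.
set k := D + S + 76 + K + 7; have k_growth : 5 * (k + 10) <= 2 ^ k by apply: growth.
have base_le : 846 * (840 * (2 ^ k) ^ 2) <= 2 ^ (2 * (k + 10)).
  by rewrite mulnA; apply: sqr_pow2_le; clear; lia.
apply: (@leq_ltn_trans (D * 2 ^ (2 * (k + 10) * (6 + 70 * (840 * 2 ^ k).+1 + S)))).
  by rewrite leq_mul // expnM leq_expl.
apply: (@leq_trans (2 ^ D * 2 ^ (2 * (k + 10) * (6 + 70 * (840 * 2 ^ k).+1 + S)))).
  by rewrite ltn_pmul2r ?expn_gt0 // ltn_expl.
rewrite -expnD leq_exp2l //.
have : D + S + 76 <= k by lia.
have : k < 2 ^ k by apply: ltn_expl.
move: (2 ^ k) k_growth => u; clear; move=> *.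
have : k + 10 <= u by lia.
nia.
Qed.

(** The estimates [mult] and [ratio] are multiplied together, with factorials abstracted to
    variables: V is 4^(70 y), W is 2^(32 y), and b2, b4, bq, bS bound the subexponential losses. *)
Lemma chain_lt D n2 Lx A F842' P F2' F3 P' den num V W F842 F2 b2 b4 bS bq xq xS :
  F842' <= F842 * b4 -> F2 <= F2' -> n2 <= b2 -> xq <= bq -> xS <= bS ->
  Lx * P' * den <= xq * (num * V) ->
  V * W * (num * A * F842) <= den * (P * P' * F2 * F3) * xS ->
  D * (b2 * b4 * bq * bS) < W ->
  0 < P' -> 0 < den -> 0 < W -> 0 < P -> 0 < F2 -> 0 < F3 ->
  D * (n2 * (Lx * A * F842')) < P * F2' * F3.
Proof.
move=> F842_le F2_le n2_le xq_le xS_le mult ratio large P'_gt0 den_gt0 W_gt0 P_gt0 F2_gt0 F3_gt0.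
have Q_gt0 : 0 < P' * den * W by rewrite !muln_gt0 P'_gt0 den_gt0.
have R_gt0 : 0 < P * F2 * F3 by rewrite !muln_gt0 P_gt0 F2_gt0.
rewrite -(ltn_pmul2r Q_gt0).
apply: (@leq_ltn_trans (D * b2 * b4 * bq * (V * W * (num * A * F842)))).
  apply: (@leq_trans (D * b2 * (F842 * b4) * A * W * (Lx * P' * den))).
    rewrite (_ : _ * _ * (P' * den * W) = D * n2 * F842' * A * W * (Lx * P' * den)); last ring.
    by rewrite !leq_mul.
  apply: leq_trans (leq_mul (leqnn _) (leq_trans mult (leq_mul xq_le (leqnn _)))) _.
  by apply: eq_leq; ring.
apply: leq_ltn_trans (leq_mul (leqnn _) (leq_trans ratio (leq_mul (leqnn _) xS_le))) _.
apply: (@leq_ltn_trans (D * (b2 * b4 * bq * bS) * (P' * den) * (P * F2 * F3))).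
  by apply: eq_leq; ring.
have Q'_gt0 : 0 < P' * den by move: Q_gt0; rewrite muln_gt0 => /andP[].
apply: (@leq_trans (W * (P' * den) * (P * F2 * F3))).
  by rewrite ltn_pmul2r // ltn_pmul2r.
rewrite [W * _]mulnC mulnC leq_mul // leq_mul // leq_mul //.
Qed.

(* After division by the right-hand side, the left-hand side is D times an upper bound
   for the linear form multiplied by its denominator; see [peak_small]. *)
Lemma small_multiplier D K : exists y, [/\ K <= y, 0 < y &
  D * ((42 * y) ^ 2 * (slcm (42 * y) (840 * y) ^ 70 *
    ((42 * y)`! * (84 * y)`!) ^ 70 * (842 * y + 4)`!)) <
  (840 * y)`!`_(smooth (42 * y)) * (2 * y + 3)`! * (126 * y)`! ^ 70].
Proof.
have [k [le_Kk k_large]] := pow2_dominates D (weight denominator_list) K.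
have u_gt0 : 0 < 2 ^ k by rewrite expn_gt0.
have le_Ku : K <= 2 ^ k by apply: leq_trans le_Kk (ltnW (ltn_expl _ _)).
move: (2 ^ k) u_gt0 le_Ku k_large => u u_gt0 le_Ku.
set y := 840 * u ^ 2; set q := 840 * u => large.
have y_gt0 : 0 < y by rewrite /y; nia.
exists y; split=> //; first by rewrite /y; nia.
have xq : 840 * y < q.+1 ^ 2 by rewrite /y /q; nia.
have qn : q <= 42 * y by rewrite /y /q; nia.
have mult := multiplier_bound y_gt0 xq qn.
have ratio := factorial_ratio_bound y_gt0.
have Enum : fact_list numerator_list y = fact_prod_of cert_num (840 * y) *
    ((42 * y)`! * (84 * y)`!) ^ 70 * (842 * y)`!.
  rewrite /numerator_list fact_list_cat -fact_prod_of_list //.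
  rewrite -mulnA; congr (_ * _).
  by rewrite /fact_list !big_cons big_nil expn1 muln1 expnMn mulnA.
have Eden : fact_list denominator_list y = fact_prod_of cert_den (840 * y) *
    ((840 * y)`! * (2 * y)`! * (126 * y)`! ^ 70).
  rewrite /denominator_list fact_list_cat -fact_prod_of_list //.
  congr (_ * _).
  by rewrite /fact_list !big_cons big_nil !expn1 muln1 mulnA.
move: (weight _) large ratio => S large; rewrite {}Enum {}Eden.
set P' := (840 * y)`!`_(smooth _)^' in mult *; set P := (840 * y)`!`_(smooth _).
have PP' : (840 * y)`! = P * P' by rewrite partnC ?fact_gt0.
have P'_gt0 : 0 < P' by apply: part_gt0.
have P_gt0 : 0 < P by apply: part_gt0.
move: (slcm _ _ ^ 70) mult => Lx mult.
rewrite {}PP' => ratio.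
have b_ge c : c <= 846 -> c * y <= 846 * y by move=> le_c; rewrite leq_mul2r le_c orbT.
have EVW : 2 ^ (172 * y) = 4 ^ (70 * y) * 2 ^ (32 * y).
  by rewrite -(expnM 2 2 (70 * y)) -expnD mulnA -mulnDl.
(* The exponent 6 pays 2 for n^2 and 4 for the shift in (842 y + 4)!. *)
rewrite {}EVW in ratio; rewrite -[6]/(2 + 4) !(expnD (846 * y)) in large.
apply: (chain_lt _ _ _ _ _ mult ratio large P'_gt0 _ _ P_gt0).
- by apply: leq_trans (fact_add_le _ _) _; rewrite leq_mul2l leq_expl ?orbT //; clear -y_gt0; lia.
- by apply: leq_trans (fact_add_ge _ _); rewrite leq_pmulr // expn_gt0 muln_gt0 y_gt0.
- by rewrite leq_expl // b_ge.
- by rewrite leq_expl // b_ge.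
- by rewrite leq_expl // b_ge.
- exact: fact_prod_of_gt0.
- by rewrite expn_gt0.
- exact: fact_gt0.
- by rewrite expn_gt0 fact_gt0.
Qed.

(** * Partial fractions *)

Local Open Scope ring_scope.

(** * Partial fractions from local congruences *)

Section PartialFractions.
Variable F : fieldType.
Implicit Types p q : {poly F}.

Lemma dvdp_prod_pow_XsubC (I : eqType) (r : seq I) (c : I -> F) (s : nat) q :
  uniq r -> {in r &, injective c} ->
  (forall i, i \in r -> ('X - (c i)%:P) ^+ s %| q) ->
  \prod_(i <- r) ('X - (c i)%:P) ^+ s %| q.
Proof.
elim: r => [|i r IH] /=; first by rewrite big_nil dvd1p.
case/andP=> ni ur c_inj q_div; rewrite big_cons Gauss_dvdp.
  rewrite q_div ?mem_head //= IH // => [j k jr kr|j jr].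
    by apply: c_inj; rewrite inE ?jr ?kr orbT.
  by apply: q_div; rewrite inE jr orbT.
rewrite coprimep_expl // coprimep_sym big_seq.
elim/big_ind: _ => [|u v cu cv|j jr]; rewrite ?coprime1p //.
  by rewrite coprimepMl cu.
rewrite coprimep_expl // coprimep_XsubC root_XsubC.
apply: contraNneq ni => eq_c; rewrite (c_inj i j) ?mem_head //.
by rewrite inE jr orbT.
Qed.

Lemma size_prod_exp_XsubC (I : finType) (P : pred I) (c : I -> F) (s : nat) :
  size (\prod_(i | P i) ('X - (c i)%:P) ^+ s) = (#|P| * s).+1.
Proof.
rewrite size_prod => [|i _]; last by rewrite expf_neq0 ?polyXsubC_eq0.
rewrite (eq_bigr (fun=> s.+1)) => [|i _]; last by rewrite size_exp_XsubC.
by rewrite sum_nat_const mulnS -addnS addKn.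
Qed.

Lemma partial_fractions (n s : nat) (c : 'I_n -> F) (A : 'I_n -> {poly F}) p :
  injective c -> (size p <= n * s)%N -> (forall k, (size (A k) <= s)%N) ->
  (forall k, ('X - (c k)%:P) ^+ s %|
     p - A k * \prod_(l < n | l != k) ('X - (c l)%:P) ^+ s) ->
  p = \sum_(k < n) A k * \prod_(l < n | l != k) ('X - (c l)%:P) ^+ s.
Proof.
move=> c_inj p_size A_size p_mod; apply/eqP; rewrite -subr_eq0.
set d := p - _.
have d_div : \prod_(k < n) ('X - (c k)%:P) ^+ s %| d.
  apply: dvdp_prod_pow_XsubC (index_enum_uniq _) (in2W c_inj) _ => k _.
  rewrite /d (bigD1 k) //= opprD addrA dvdp_sub ?p_mod //.
  apply: (big_ind (fun u => _ %| u)) => [|u v du dv|l lk]; rewrite ?dvdp0 ?dvdp_add //.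
  by rewrite dvdp_mull // (bigD1 k) /= ?dvdp_mulr // eq_sym.
have size_d : (size d <= n * s)%N.
  rewrite (leq_trans (size_polyD _ _)) // geq_max p_size size_polyN.
  rewrite (leq_trans (size_sum _ _ _)) //; apply/bigmax_leqP => k _.
  rewrite (leq_trans (size_polyMleq _ _)) // size_prod_exp_XsubC cardC1 card_ord.
  rewrite addnS /= -[X in (_ <= X * _)%N](ltn_predK (ltn_ord k)) mulSn leq_add2r.
  exact: A_size.
apply: contraLR size_d => d_neq0; have := dvdp_leq d_neq0 d_div.
by rewrite size_prod_exp_XsubC cardT size_enum_ord -ltnNge.
Qed.
End PartialFractions.

Lemma prod_around (A : comNzRingType) (f : nat -> A) (u m : nat) : (u <= m)%N ->
  \prod_(j < m.+1 | (j : nat) != u) f j =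
  \prod_(1 <= i < u.+1) f (u - i)%N * \prod_(1 <= i < (m - u).+1) f (u + i)%N.
Proof.
move=> /subnKC <-; move: (m - u)%N => w; rewrite addKn.
rewrite -(big_mkord (fun j => j != u)) (big_cat_nat _ (n := u)) ?leqW ?leq_addr //=.
congr (_ * _).
  rewrite big_nat_rev big_add1 /= big_nat_cond [RHS]big_nat_cond.
  by apply: eq_big => i; rewrite ?add0n //; lia.
rewrite big_ltn_cond ?ltnS ?leq_addr // eqxx /=.
rewrite -[u.+1]add1n big_addn (_ : (u + w).+1 - u = w.+1)%N; last by lia.
rewrite big_nat_cond [RHS]big_nat_cond; apply: eq_big => i; last by rewrite addnC.
lia.
Qed.

(** * Integral local expansions at the poles *)

Section LocalExpansion.
Variables (R : numFieldType) (Z : subringClosed R).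
Implicit Types (L c : R) (n s k : nat).

Lemma natr_div_int (a b : nat) : (b %| a)%N -> (a%:R / b%:R : R) \in Z.
Proof.
case/dvdnP=> q ->; rewrite natrM; have [->|b_neq0] := eqVneq (b%:R : R) 0.
  by rewrite invr0 mulr0 rpred0.
by rewrite mulfK ?rpred_nat.
Qed.

(** The inverse of 1 + c X modulo X^s. *)
Definition geom_trunc c s : {poly R} := \sum_(m < s) (- c *: 'X) ^+ m.

Lemma geom_truncP c s :
  (1 + c *: 'X) * geom_trunc c s = 1 - (- c) ^+ s *: 'X^s.
Proof.
by rewrite /geom_trunc -exprZn -[RHS]opprB subrX1 -mulNr opprB scaleNr opprK.
Qed.

Lemma geom_trunc_int c s : c \in Z -> geom_trunc c s \is a polyOver Z.
Proof.
move=> c_int; apply: rpred_sum => m _; apply: rpredX.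
by rewrite polyOverZ ?rpredN ?polyOverX.
Qed.

Lemma dvdp_prod_sub1 (I : Type) (r : seq I) (P : pred I) (u : I -> {poly R}) d :
  (forall i, P i -> d %| u i - 1) -> d %| \prod_(i <- r | P i) u i - 1.
Proof.
move=> u1; elim/big_ind: _ => [|x y dx dy|i Pi]; rewrite ?subrr ?dvdp0 ?u1 //.
have -> : x * y - 1 = x * (y - 1) + (x - 1) by ring.
by rewrite dvdp_add // dvdp_mull.
Qed.

(** Since a = - b x, the terms a q_m + b q_(m - 1) telescope and only the top coefficient
    remains. *)
Lemma sum_truncated_root (p q : {poly R}) (a b x : R) s :
  p = (a%:P + b *: 'X) * q -> a + b * x = 0 -> x != 0 ->
  \sum_(m < s.+1) p`_m * x^-1 ^+ (s.+1 - m) = - b * q`_s.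
Proof.
move=> -> ab0 x_neq0.
have coef_p m : ((a%:P + b *: 'X) * q)`_m.+1 = a * q`_m.+1 + b * q`_m.
  by rewrite mulrDl coefD coefCM -scalerAl coefZ coefXM.
have ax c : x^-1 * (a * c) = - b * c.
  have -> : a = - (b * x) by apply/eqP; rewrite -subr_eq0 opprK ab0.
  by field.
elim: s => [|s IH].
  by rewrite big_ord1 expr1 mulrDl coefD coefCM -scalerAl coefZ coefXM mulr0 addr0 mulrC ax.
rewrite big_ord_recr /= subSnn expr1.
under eq_bigr => m _ do rewrite subSn 1?ltnW // exprSr mulrA.
rewrite -mulr_suml IH coef_p -mulrDl addrC mulNr addrK.
by rewrite mulrC ax.
Qed.

Variables n s : nat.
Let N := (20 * n)%N.
Let L : R := (slcm n N)%:R.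
Local Notation "m `_pi" := (m `_(smooth n))%N (at level 2, format "m `_pi").

Definition rat_cst : R := (n`! ^ s)%:R / (N`!`_pi)%:R.

Definition num_poly : {poly R} :=
  rat_cst *: \prod_(j < N.+1) (4 *: 'X + j%:R - (8 * n)%:R).

(* The expansion of num_poly / prod_(l != k) (t + l) ^ s at t = -k in the variable
   (t + k) / L, correct modulo its s-th power; rescaling by L makes it integral. *)
Definition local_poly (k : nat) : {poly R} :=
  (rat_cst / \prod_(l < n.+1 | (l : nat) != k) (l%:R - k%:R) ^+ s) *:
  (\prod_(j < N.+1) ((4 * L) *: 'X + j%:R - (4 * k + 8 * n)%:R) *
   \prod_(l < n.+1 | (l : nat) != k) geom_trunc (L / (l%:R - k%:R)) s ^+ s).

Lemma L_neq0 : L != 0.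
Proof. by rewrite pnatr_eq0 -lt0n slcm_gt0. Qed.

Lemma part_fact u : (u`!)`_pi = (\prod_(1 <= i < u.+1) i`_pi)%N.
Proof.
elim: u => [|u IH]; first by rewrite big_geq // partn1.
by rewrite factS partnM ?fact_gt0 // IH [RHS]big_nat_recr //= mulnC.
Qed.

(** The numerator factor 4 L X + e i, with e = 1 or -1, divided by the smooth part of i. That part
    divides L for i <= N, and the extracted parts multiply to the smooth part of a factorial. *)
Definition lin_factor (e : R) i : {poly R} :=
  (e * (i`_(smooth n)^')%:R)%:P + (4 * (L / (i`_pi)%:R)) *: 'X.

Lemma lin_factor_int e i : e \in Z -> (0 < i <= N)%N -> lin_factor e i \in polyOver Z.
Proof.
move=> e_int i_bnd; apply: rpredD; first by rewrite polyOverC rpredM ?rpred_nat.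
apply: polyOverZ; rewrite ?polyOverX //; apply: rpredM; first exact: rpred_nat.
by apply: natr_div_int; apply: part_dvd_slcm.
Qed.

Lemma lin_factorE (e : R) i : (0 < i)%N ->
  (4 * L) *: 'X + (e * i%:R)%:P = (i`_pi)%:R *: lin_factor e i.
Proof.
move=> i_gt0; rewrite /lin_factor scalerDr scalerA addrC; congr (_ + _).
  by rewrite -mul_polyC -polyCM mulrCA -natrM partnC.
by congr (_ *: _); field; rewrite pnatr_eq0 -lt0n part_gt0.
Qed.

Lemma prod_lin_factor (e : R) u :
  \prod_(1 <= i < u.+1) ((4 * L) *: 'X + (e * i%:R)%:P) =
  ((u`!)`_pi)%:R *: \prod_(1 <= i < u.+1) lin_factor e i.
Proof.
rewrite part_fact natr_prod -scaler_prod big_nat_cond [RHS]big_nat_cond.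
by apply: eq_bigr => i /andP[/andP[i_gt0 _] _]; rewrite lin_factorE.
Qed.

Lemma prod_pole_diff k : (k <= n)%N ->
  \prod_(l < n.+1 | (l : nat) != k) (l%:R - k%:R) =
  (-1) ^+ k * (k`! * (n - k)`!)%:R :> R.
Proof.
move=> le_kn; rewrite (prod_around (fun l => l%:R - k%:R) le_kn) natrM mulrA.
congr (_ * _); last first.
  by rewrite fact_prod natr_prod; apply: eq_bigr => i _; rewrite natrD addrC addKr.
rewrite fact_prod natr_prod.
have -> : \prod_(1 <= i < k.+1) ((k - i)%:R - k%:R) =
    \prod_(1 <= i < k.+1) ((-1) * i%:R) :> R.
  rewrite big_nat_cond [RHS]big_nat_cond; apply: eq_bigr => i.
  by case/andP=> /andP[_ lt_ik] _; rewrite natrB // mulN1r addrC addKr.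
by rewrite big_split /= prodr_const_nat subn1.
Qed.

Lemma prod_pole_neq0 k : (k <= n)%N ->
  \prod_(l < n.+1 | (l : nat) != k) (l%:R - k%:R) != 0 :> R.
Proof.
move=> le_kn; rewrite prod_pole_diff //.
by rewrite mulf_neq0 ?signr_eq0 // pnatr_eq0 -lt0n muln_gt0 !fact_gt0.
Qed.

(** The factor j = u vanishes at t = -k and becomes 4 L X; u factors lie below it and w = N - u
    above. Its L times the smooth part of u! w! is a multiple of the smooth part of N!, and k! (n -
    k)! divides n!, so the constant lies in [Z]. *)
Lemma local_poly_factor k : (k <= n)%N ->
  exists2 C : R, C \in Z & local_poly k =
    C *: (4 *: 'X * \prod_(1 <= i < (4 * k + 8 * n).+1) lin_factor (-1) i *
          \prod_(1 <= i < (12 * n - 4 * k).+1) lin_factor 1 i *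
          \prod_(l < n.+1 | (l : nat) != k) geom_trunc (L / (l%:R - k%:R)) s ^+ s).
Proof.
move=> le_kn; set u := (4 * k + 8 * n)%N; set w := (12 * n - 4 * k)%N.
have DN : N = (u + w)%N by rewrite /N /u /w; lia.
exists ((n`! ^ s)%:R / \prod_(l < n.+1 | (l : nat) != k) (l%:R - k%:R) ^+ s *
        ((slcm n N * (u`! * w`!)`_pi)%:R / (N`!`_pi)%:R)).
  apply: rpredM; last by apply: natr_div_int; rewrite DN fact_part_dvd.
  rewrite prodrXl prod_pole_diff // natrX -expr_div_n rpredX // invfM mulrCA.
  rewrite rpredM -?exprVn ?invrN ?invr1 ?rpredX ?rpredN ?rpred1 //.
  by apply: natr_div_int; rewrite -(bin_fact le_kn) dvdn_mull.
rewrite /local_poly scalerAl -/N -/u.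
have -> : \prod_(j < N.+1) ((4 * L) *: 'X + j%:R - u%:R : {poly R}) =
   (L * (u`!`_pi)%:R * (w`!`_pi)%:R) *:
   (4 *: 'X * \prod_(1 <= i < u.+1) lin_factor (-1) i * \prod_(1 <= i < w.+1) lin_factor 1 i).
  have le_uN : (u <= N)%N by lia.
  rewrite (bigD1 (Ordinal (le_uN : u < N.+1)%N)) //= addrK.
  rewrite (eq_bigl (fun j : 'I__ => (j : nat) != u)) => [|j]; last by rewrite -val_eqE.
  rewrite (prod_around (fun j => (4 * L) *: 'X + j%:R - u%:R) le_uN).
  rewrite (_ : N - u = w)%N; last by lia.
  have -> : \prod_(1 <= i < u.+1) ((4 * L) *: 'X + (u - i)%:R - u%:R : {poly R}) =
            \prod_(1 <= i < u.+1) ((4 * L) *: 'X + (-1 * i%:R)%:P).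
    rewrite big_nat_cond [RHS]big_nat_cond; apply: eq_bigr => i.
    case/andP=> /andP[_ lt_iu] _.
    by rewrite mulN1r polyCN polyC_natr natrB // addrA addrAC addrK.
  have -> : \prod_(1 <= i < w.+1) ((4 * L) *: 'X + (u + i)%:R - u%:R : {poly R}) =
            \prod_(1 <= i < w.+1) ((4 * L) *: 'X + (1 * i%:R)%:P).
    by apply: eq_bigr => i _; rewrite mul1r polyC_natr natrD addrA addrAC addrK.
  rewrite !prod_lin_factor; move: (\prod_(1 <= i < _) lin_factor (-1) i) => p.
  move: (\prod_(1 <= i < _) lin_factor 1 i) => q.
  by rewrite -!mul_polyC !polyCM; ring.
have Ec : rat_cst / \prod_(l < n.+1 | (l : nat) != k) (l%:R - k%:R) ^+ s *
    (L * (u`!`_pi)%:R * (w`!`_pi)%:R) =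
  (n`! ^ s)%:R / \prod_(l < n.+1 | (l : nat) != k) (l%:R - k%:R) ^+ s *
    ((slcm n N * (u`! * w`!)`_pi)%:R / (N`!`_pi)%:R).
  by rewrite /rat_cst -/N partnM ?fact_gt0 // !natrM -/L; ring.
rewrite -{}Ec; move: (rat_cst / _) (L * _ * _) => c1 c2.
move: (\prod_(1 <= i < _) lin_factor (-1) i) => p.
move: (\prod_(1 <= i < _) lin_factor 1 i) (\prod_(l < _ | _) geom_trunc _ _ ^+ s) => q g.
by rewrite -!mul_polyC !polyCM; ring.
Qed.

(** The distance of l and k is at most n, hence its own n-smooth part, and divides L. *)
Lemma pole_diff_int l k : (l <= n)%N -> (k <= n)%N -> l != k -> L / (l%:R - k%:R) \in Z.
Proof.
move=> le_ln le_kn neq_lk.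
suff divL (a : nat) : (0 < a <= n)%N -> L / a%:R \in Z.
  case: (ltngtP l k) neq_lk => // lt_lk _; last by rewrite -natrB 1?ltnW // divL; lia.
  by rewrite -opprB invrN mulrN rpredN -natrB 1?ltnW // divL; lia.
case/andP=> a_gt0 le_an; apply: natr_div_int.
have le_aN : (0 < a <= N)%N by rewrite a_gt0 /N; lia.
apply: dvdn_trans (part_dvd_slcm n le_aN).
rewrite part_pnat_id // /pnat a_gt0; apply/allP => p.
rewrite mem_primes => /and3P[_ _ /(dvdn_leq a_gt0) le_pa].
exact: leq_trans le_pa le_an.
Qed.

Lemma prod_geom_int k : (k <= n)%N ->
  \prod_(l < n.+1 | (l : nat) != k) geom_trunc (L / (l%:R - k%:R)) s ^+ s \in polyOver Z.
Proof.
move=> le_kn; apply: rpred_prod => l neq_lk; apply: rpredX; apply: geom_trunc_int.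
by apply: pole_diff_int => //; rewrite -ltnS.
Qed.

Lemma prod_lin_factor_int (e : R) u : e \in Z -> (u <= N)%N ->
  \prod_(1 <= i < u.+1) lin_factor e i \in polyOver Z.
Proof.
move=> e_int le_uN; rewrite big_nat_cond; apply: rpred_prod => i.
case/andP=> /andP[i_gt0 lt_iu] _; apply: lin_factor_int => //.
by rewrite i_gt0 (leq_trans _ le_uN).
Qed.

Lemma local_poly_int k : (k <= n)%N -> local_poly k \in polyOver Z.
Proof.
move=> le_kn; have [C C_int ->] := local_poly_factor le_kn.
apply: polyOverZ => //; rewrite !rpredM ?prod_geom_int //.
- by apply: polyOverZ; rewrite ?rpred_nat ?polyOverX.
- by apply: prod_lin_factor_int; rewrite ?rpredN ?rpred1 // /N; lia.
- by apply: prod_lin_factor_int; rewrite ?rpred1 // /N; lia.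
Qed.

(* The pole at -k contributes to the value at e/4 - k a multiple of L ^- s only,
   because the numerator vanishes there. *)
Lemma local_poly_root k e : (0 < s)%N -> (k <= n)%N -> (0 < e <= 4 * k)%N ->
  \sum_(m < s) (local_poly k)`_m * (4 * L / e%:R) ^+ (s - m) \in Z.
Proof.
move=> s_gt0 le_kn /andP[e_gt0 le_e4k].
have [C C_int ->] := local_poly_factor le_kn.
have le_e : (1 <= e < (4 * k + 8 * n).+1)%N by lia.
(* The factor at distance e below j = 4 k + 8 n is the one that vanishes at t = e/4 - k. *)
rewrite (bigD1_seq e) ?mem_index_iota ?iota_uniq //=.
set q1 := \prod_(i <- _ | _) _; set q2 := \prod_(_ <= i < _) _; set q3 := \prod_(l < _ | _) _.
set a := -1 * (e`_(smooth n)^')%:R : R; set b := 4 * (L / (e`_pi)%:R) : R.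
have e_neq0 : e%:R != 0 :> R by rewrite pnatr_eq0 -lt0n.
have Ep : C *: (4 *: 'X * (lin_factor (-1) e * q1) * q2 * q3) =
          (a%:P + b *: 'X) * (C *: (4 *: 'X * q1 * q2 * q3)).
  by rewrite -/(lin_factor (-1) e) -[RHS]scalerAr; congr (_ *: _); ring.
have x_neq0 : e%:R / (4 * L) != 0 :> R.
  by rewrite mulf_neq0 // invr_neq0 // mulf_neq0 ?L_neq0 // pnatr_eq0.
have root_x : a + b * (e%:R / (4 * L)) = 0.
  rewrite /a /b -{3}(partnC (smooth n) e_gt0) natrM.
  have pi_neq0 : (e`_pi)%:R != 0 :> R by rewrite pnatr_eq0 -lt0n part_gt0.
  have L_neq := L_neq0.
  by field; rewrite pi_neq0 L_neq.
have := sum_truncated_root s.-1 Ep root_x x_neq0; rewrite prednK // invf_div => ->.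
apply: rpredM.
  rewrite rpredN; apply: rpredM; first exact: rpred_nat.
  by apply: natr_div_int; apply: part_dvd_slcm; rewrite e_gt0 /N; lia.
suff /polyOverP -> : C *: (4 *: 'X * q1 * q2 * q3) \in polyOver Z by [].
apply: polyOverZ => //; rewrite !rpredM ?prod_geom_int //.
- by apply: polyOverZ; rewrite ?rpred_nat ?polyOverX.
- rewrite /q1 big_seq_cond; apply: rpred_prod => i; rewrite mem_index_iota => /andP[i_bnd _].
  apply: lin_factor_int; first by rewrite rpredN rpred1.
  rewrite /N; lia.
- by apply: prod_lin_factor_int; rewrite ?rpred1 // /N; lia.
Qed.

Lemma prod_rev_pole (A : comNzRingType) (f : nat -> A) k : (k <= n)%N ->
  \prod_(l < n.+1 | (l : nat) != (n - k)%N) f l =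
  \prod_(l < n.+1 | (l : nat) != k) f (n - l)%N.
Proof.
move=> le_kn; rewrite (reindex_inj rev_ord_inj) /=.
by apply: eq_big => l; rewrite subSS //; have := ltn_ord l; lia.
Qed.

Lemma coef_comp_opp (p : {poly R}) m : (p \Po - 'X)`_m = (-1) ^+ m * p`_m.
Proof.
have -> : - 'X = (-1) *: 'X :> {poly R} by rewrite scaleN1r.
rewrite coef_comp_poly; under eq_bigr => i _ do rewrite exprZn coefZ coefXn.
have [lt_m|le_m] := ltnP m (size p).
  rewrite (bigD1 (Ordinal lt_m)) //= eqxx mulr1 big1 ?addr0 1?mulrC // => i neq_im.
  by rewrite eq_sym (negbTE neq_im : ((i : nat) == m) = false) !mulr0.
rewrite nth_default // mulr0 big1 // => i _.
by rewrite gtn_eqF ?mulr0 // (leq_trans (ltn_ord i)).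
Qed.

(** The reflection exchanges k with n - k and j with N - j. It negates each of the N + 1 numerator
    factors, an odd number, while the even power s hides the signs of the pole factors. *)
Lemma local_poly_sym k : ~~ odd s -> (k <= n)%N ->
  local_poly (n - k) \Po - 'X = - local_poly k.
Proof.
move=> s_even le_kn; rewrite /local_poly comp_polyZ rmorphM /= !rmorph_prod /=.
have natB (l : 'I_n.+1) : (n - l)%:R - (n - k)%:R = - (l%:R - k%:R) :> R.
  by rewrite !natrB // -1?ltnS //; ring.
have -> : \prod_(l < n.+1 | (l : nat) != (n - k)%N) (l%:R - (n - k)%:R) ^+ s =
          \prod_(l < n.+1 | (l : nat) != k) (l%:R - k%:R) ^+ s :> R.
  rewrite (prod_rev_pole (fun l => (l%:R - (n - k)%:R) ^+ s)) //.
  apply: eq_bigr => l _; rewrite natB.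
  by rewrite exprNn -signr_odd (negbTE s_even) mul1r.
rewrite -scalerN -mulNr; congr (_ *: (_ * _)); last first.
  rewrite (prod_rev_pole (fun l => geom_trunc (L / (l%:R - (n - k)%:R)) s ^+ s \Po - 'X)) //.
  apply: eq_bigr => l _; rewrite rmorphXn /= natB; congr (_ ^+ _).
  rewrite /geom_trunc rmorph_sum; apply: eq_bigr => m _.
  rewrite rmorphXn /= comp_polyZ comp_polyX; congr (_ ^+ _).
  by rewrite invrN mulrN opprK scalerN scaleNr.
rewrite (reindex_inj rev_ord_inj) /=.
have -> : \prod_(j < N.+1) (((4 * L) *: 'X + (N.+1 - j.+1)%:R - (4 * (n - k) + 8 * n)%:R) \Po - 'X) =
  \prod_(j < N.+1) (- 1 * ((4 * L) *: 'X + j%:R - (4 * k + 8 * n)%:R : {poly R})).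
  apply: eq_bigr => j _; rewrite subSS natrB -1?ltnS //.
  rewrite rmorphB rmorphD rmorphB /= !rmorph_nat comp_polyZ comp_polyX scalerN.
  have -> : (4 * (n - k) + 8 * n = N - (4 * k + 8 * n))%N by rewrite /N; lia.
  rewrite natrB; last by rewrite /N; lia.
  by ring.
rewrite big_split /= prodr_const card_ord -signr_odd /= oddM /= expr1.
by rewrite mulN1r.
Qed.

(** The coefficient of 1 / (t + k)^i; the power of 1 / L undoes the rescaling of the variable. *)
Definition pf_coef k i : R := L^-1 ^+ (s - i) * (local_poly k)`_(s - i).

Lemma pf_coef_int k i : (k <= n)%N -> (i <= s)%N -> L ^+ s * pf_coef k i \in Z.
Proof.
move=> le_kn le_is; rewrite /pf_coef mulrA -{1}(subnKC le_is) exprD -mulrA.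
rewrite mulrA -[L ^+ i * _ * _]mulrA -exprMn mulfV ?L_neq0 // expr1n mulr1.
rewrite rpredM ?rpredX ?rpred_nat //.
exact: (polyOverP (local_poly_int le_kn)).
Qed.

Lemma pf_coef_even i : ~~ odd s -> (i <= s)%N -> ~~ odd i ->
  \sum_(k < n.+1) pf_coef k i = 0.
Proof.
move=> s_even le_is i_even; rewrite /pf_coef -mulr_sumr.
suff Esum : \sum_(k < n.+1) (local_poly k)`_(s - i) = - \sum_(k < n.+1) (local_poly k)`_(s - i).
  have /eqP : (\sum_(k < n.+1) (local_poly k)`_(s - i)) *+ 2 = 0.
    by rewrite mulr2n {1}Esum addNr.
  by rewrite mulrn_eq0 /= => /eqP ->; rewrite mulr0.
rewrite {1}(reindex_inj rev_ord_inj) /= -sumrN; apply: eq_bigr => k _.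
have le_kn : (k <= n)%N by rewrite -ltnS.
rewrite -coefN -(local_poly_sym s_even le_kn) coef_comp_opp subSS.
by rewrite -signr_odd oddB // (negbTE s_even) (negbTE i_even) mul1r.
Qed.

Lemma coef_mul_top (p q : {poly R}) a b :
  (size p <= a.+1)%N -> (size q <= b.+1)%N -> (p * q)`_(a + b) = p`_a * q`_b.
Proof.
move=> p_size q_size; rewrite coefM.
have lt_a : (a < (a + b).+1)%N by rewrite ltnS leq_addr.
rewrite (bigD1 (Ordinal lt_a)) //= addKn big1 ?addr0 // => i neq_ia.
have {}neq_ia : (i : nat) != a by [].
have [lt_ia|lt_ai|Eia] := ltngtP (i : nat) a; last by rewrite Eia eqxx in neq_ia.
  by rewrite [q`__]nth_default ?mulr0 //; apply: leq_trans q_size _; lia.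
by rewrite nth_default ?mul0r //; apply: leq_trans p_size _; lia.
Qed.

(** The numerator over (t + k)^s of the principal part at -k. *)
Definition pf_poly k : {poly R} := take_poly s (local_poly k) \Po (L^-1 *: ('X + k%:R)).

Lemma size_lin (k : nat) : size ('X + k%:R : {poly R}) = 2.
Proof. by rewrite -polyC_natr size_XaddC. Qed.

Lemma pf_polyE k :
  pf_poly k = \sum_(m < s) (L^-1 ^+ m * (local_poly k)`_m) *: ('X + k%:R) ^+ m.
Proof.
rewrite /pf_poly /take_poly poly_def rmorph_sum /=; apply: eq_bigr => m _.
by rewrite comp_polyZ rmorphXn /= comp_polyX exprZn scalerA mulrC.
Qed.

Lemma size_pf_poly k : (size (pf_poly k) <= s)%N.
Proof.
rewrite pf_polyE (leq_trans (size_sum _ _ _)) //; apply/bigmax_leqP => m _.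
rewrite (leq_trans (size_scale_leq _ _)) //.
by rewrite (leq_trans (size_poly_exp_leq _ _)) // size_lin mul1n.
Qed.

(** The substitution t = L X - k turns the claim into a congruence modulo X^s, where each truncated
    geometric series inverts its pole factor. *)
Lemma pf_congruence k : (k <= n)%N ->
  ('X + k%:R) ^+ s %|
    num_poly - pf_poly k * \prod_(l < n.+1 | (l : nat) != k) ('X + l%:R) ^+ s.
Proof.
move=> le_kn; set D := num_poly - _.
pose sigma : {poly R} := L *: 'X - k%:R.
pose tau : {poly R} := L^-1 *: ('X + k%:R).
have sigmaK : sigma \Po tau = 'X.
  rewrite /sigma /tau rmorphB /= rmorph_nat comp_polyZ comp_polyX scalerA.
  by rewrite mulfV ?L_neq0 // scale1r addrK.
have tauK : tau \Po sigma = 'X.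
  rewrite /sigma /tau comp_polyZ rmorphD /= rmorph_nat comp_polyX subrK scalerA.
  by rewrite mulVf ?L_neq0 // scale1r.
suff : 'X^s %| D \Po sigma.
  case/dvdpP=> q Eq; have -> : D = (D \Po sigma) \Po tau.
    by rewrite -comp_polyA sigmaK comp_polyXr.
  rewrite Eq rmorphM rmorphXn /= comp_polyX /tau exprZn.
  by rewrite dvdp_mull // -mul_polyC dvdp_mull.
set p := local_poly k.
pose U := \prod_(l < n.+1 | (l : nat) != k)
  ((1 + (L / (l%:R - k%:R)) *: 'X) * geom_trunc (L / (l%:R - k%:R)) s) ^+ s : {poly R}.
pose Q := \prod_(l < n.+1 | (l : nat) != k) (L *: 'X + l%:R - k%:R) ^+ s : {poly R}.
have U1 : 'X^s %| U - 1.
  apply: dvdp_prod_sub1 => l _; rewrite geom_truncP subrX1 dvdp_mulr //.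
  by rewrite addrAC subrr add0r dvdpNr -mul_polyC dvdp_mull.
have -> : D \Po sigma = (num_poly \Po sigma) - take_poly s p * Q.
  rewrite /D rmorphB rmorphM rmorph_prod /=; congr (_ - _ * _).
    by rewrite /pf_poly -comp_polyA tauK comp_polyXr.
  apply: eq_bigr => l _; rewrite rmorphXn rmorphD /= rmorph_nat comp_polyX.
  by congr (_ ^+ _); rewrite addrAC.
have pQ : p * Q = (num_poly \Po sigma) * U.
  rewrite /p /local_poly /num_poly /U /Q comp_polyZ rmorph_prod /=.
  have -> : \prod_(j < N.+1) ((4 *: 'X + j%:R - (8 * n)%:R) \Po sigma) =
            \prod_(j < N.+1) ((4 * L) *: 'X + j%:R - (4 * k + 8 * n)%:R).
    apply: eq_bigr => j _; rewrite rmorphB rmorphD /= !rmorph_nat comp_polyZ comp_polyX.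
    rewrite /sigma -!mul_polyC polyCM !polyC_natr (natrD _ (4 * k)) (natrM _ 4 k) (natrM _ 8 n).
    by ring.
  have -> : \prod_(l < n.+1 | (l : nat) != k) (L *: 'X + l%:R - k%:R) ^+ s =
      \prod_(l < n.+1 | (l : nat) != k) (l%:R - k%:R) ^+ s *:
      \prod_(l < n.+1 | (l : nat) != k) (1 + (L / (l%:R - k%:R)) *: 'X) ^+ s.
    rewrite -scaler_prod; apply: eq_bigr => l neq_lk; rewrite -exprZn; congr (_ ^+ _).
    rewrite scalerDr scalerA mulrCA mulfV ?mulr1; last first.
      by rewrite subr_eq0 eqr_nat.
    by rewrite -[_ *: 1]mul_polyC mulr1 polyCB !polyC_natr; ring.
  under [in RHS]eq_bigr => l _ do rewrite exprMn.
  rewrite big_split /= -!mul_polyC.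
  have P_neq0 : \prod_(l < n.+1 | (l : nat) != k) (l%:R - k%:R) ^+ s != 0 :> R.
    by rewrite prodrXl expf_neq0 // prod_pole_neq0.
  move: (\prod_(l < _ | _) (l%:R - k%:R) ^+ s) P_neq0 => P P_neq0.
  have <- : (rat_cst / P)%:P * P%:P = rat_cst%:P by rewrite -polyCM divfK.
  by move: (rat_cst / P)%:P P%:P => c P'; ring.
have -> : (num_poly \Po sigma) - take_poly s p * Q =
    drop_poly s p * Q * 'X^s - (num_poly \Po sigma) * (U - 1).
  have -> : take_poly s p = p - drop_poly s p * 'X^s.
    by rewrite -{2}(poly_take_drop s p) addrK.
  by rewrite mulrBl pQ; ring.
by rewrite dvdp_sub ?dvdp_mull.
Qed.

Lemma size_num_poly : (size num_poly <= N.+2)%N.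
Proof.
rewrite (leq_trans (size_scale_leq _ _)) //.
rewrite (leq_trans (size_prod_leq _ _)) //.
rewrite (leq_trans (_ : _ <= (\sum_(j < N.+1) 2).+1 - #|'I_N.+1|)%N) //.
  rewrite leq_sub2r // ltnS leq_sum // => j _.
  rewrite -addrA -polyC_natr -[(8 * n)%:R]polyC_natr -polyCB.
  rewrite (leq_trans (size_polyD _ _)) // geq_max (leq_trans (size_scale_leq _ _)) ?size_polyX //.
  by rewrite (leq_trans (size_polyC_leq1 _)).
by rewrite sum_nat_const card_ord; lia.
Qed.

Lemma num_polyE : (N.+2 <= n.+1 * s)%N ->
  num_poly = \sum_(k < n.+1) pf_poly k *
    \prod_(l < n.+1 | (l : nat) != k) ('X + l%:R) ^+ s.
Proof.
move=> le_N; have XE (l : nat) : 'X - (- l%:R)%:P = 'X + l%:R :> {poly R}.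
  by rewrite polyCN opprK polyC_natr.
rewrite {1}(partial_fractions (n := n.+1) (s := s) (c := fun l : 'I_n.+1 => - (l : nat)%:R)
  (A := fun k : 'I_n.+1 => pf_poly k) (p := num_poly)).
- by apply: eq_bigr => k _; congr (_ * _); apply: eq_bigr => l _; rewrite XE.
- by move=> i j /oppr_inj/eqP; rewrite eqr_nat => /eqP/val_inj.
- exact: leq_trans size_num_poly le_N.
- by move=> k; apply: size_pf_poly.
move=> k; rewrite XE.
under eq_bigr => l _ do rewrite XE.
by apply: pf_congruence; rewrite -ltnS.
Qed.

Lemma pf_expansion (t : R) : (N.+2 <= n.+1 * s)%N ->
  (forall l, (l <= n)%N -> t + l%:R != 0) ->
  rat_cst * \prod_(j < N.+1) (4 * t + j%:R - (8 * n)%:R) /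
    \prod_(l < n.+1) (t + l%:R) ^+ s =
  \sum_(k < n.+1) \sum_(i < s) pf_coef k i.+1 / (t + k%:R) ^+ i.+1.
Proof.
move=> le_N t_pole.
have t_neq0 (l : 'I_n.+1) : t + l%:R != 0 by rewrite t_pole // -ltnS.
have -> : rat_cst * \prod_(j < N.+1) (4 * t + j%:R - (8 * n)%:R) = num_poly.[t].
  rewrite hornerZ horner_prod; congr (_ * _); apply: eq_bigr => j _.
  by rewrite !hornerE -!polyC_natr !hornerE.
rewrite num_polyE // horner_sum mulr_suml; apply: eq_bigr => k _.
rewrite [X in _ / X](bigD1 k) //= hornerM horner_prod.
have -> : \prod_(l < n.+1 | (l : nat) != k) (('X + l%:R) ^+ s).[t] =
          \prod_(l < n.+1 | l != k) (t + l%:R) ^+ s.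
  by apply: eq_bigr => l _; rewrite horner_exp !hornerE -polyC_natr !hornerE.
rewrite -mulf_div divff ?mulr1; last first.
  by rewrite prodf_seq_neq0; apply/allP => l _; rewrite expf_neq0 ?implybT.
rewrite pf_polyE horner_sum mulr_suml (reindex_inj rev_ord_inj) /=.
apply: eq_bigr => i _; rewrite hornerZ horner_exp !hornerE -polyC_natr !hornerE /pf_coef.
rewrite -!mulrA; congr (_ * (_ * _)).
have -> : (t + k%:R) ^+ s = (t + k%:R) ^+ (s - i.+1) * (t + k%:R) ^+ i.+1.
  by rewrite -exprD subnK.
by rewrite invfM mulrA mulfV ?expf_neq0 // mul1r.
Qed.

Lemma size_lin_exp (k m : nat) : size (('X + k%:R : {poly R}) ^+ m) = m.+1.
Proof. by rewrite -polyC_natr -[k%:R]opprK polyCN size_exp_XsubC. Qed.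

(** The sum of the residues is the coefficient of degree (n + 1) s - 1 of the numerator, which
    vanishes for degree reasons. *)
Lemma pf_coef_residue : (0 < s)%N -> (N.+2 < n.+1 * s)%N ->
  \sum_(k < n.+1) pf_coef k 1 = 0.
Proof.
move=> s_gt0 lt_N; have := num_polyE (ltnW lt_N).
move/(congr1 (fun p : {poly R} => p`_(s.-1 + n * s))).
rewrite nth_default; last first.
  by rewrite (leq_trans size_num_poly) //; move: lt_N; rewrite mulSn; lia.
rewrite coef_sum => E0; rewrite [RHS]E0; apply: eq_bigr => k _.
have size_Q : size (\prod_(l < n.+1 | (l : nat) != k) ('X + l%:R) ^+ s : {poly R}) = (n * s).+1.
  under eq_bigr => l _ do rewrite -polyC_natr -[l%:R]opprK polyCN.
  by rewrite size_prod_exp_XsubC cardC1 card_ord.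
have monic_Q : \prod_(l < n.+1 | (l : nat) != k) ('X + l%:R) ^+ s \is @monic R.
  apply: rpred_prod => l _; apply: rpredX; rewrite -polyC_natr -[l%:R]opprK polyCN.
  exact: monicXsubC.
rewrite coef_mul_top ?size_Q ?prednK ?size_pf_poly //.
have -> : (\prod_(l < n.+1 | (l : nat) != k) ('X + l%:R) ^+ s)`_(n * s) = 1 :> R.
  by move/monicP: monic_Q; rewrite /lead_coef size_Q.
rewrite mulr1 pf_polyE coef_sum /pf_coef subn1.
have lt_s : (s.-1 < s)%N by rewrite prednK.
rewrite (bigD1 (Ordinal lt_s)) //= big1 ?addr0 => [|m neq_m].
  suff lead1 : (('X + k%:R : {poly R}) ^+ s.-1)`_s.-1 = 1 by rewrite [RHS]coefZ lead1 mulr1.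
  have : ('X + k%:R : {poly R}) ^+ s.-1 \is monic.
    by rewrite rpredX // -polyC_natr -[k%:R]opprK polyCN monicXsubC.
  by move/monicP; rewrite /lead_coef size_lin_exp.
rewrite [LHS]coefZ [X in _ * X]nth_default ?mulr0 // size_lin_exp.
have {}neq_m : (m : nat) != s.-1 by [].
by have := ltn_ord m; lia.
Qed.
End LocalExpansion.

(** * Size of the linear forms *)

Section Bounds.
Variable R : realFieldType.
Implicit Types (w t v : R) (n m : nat).

Definition rising m w : R := \prod_(j < m) (w + j%:R).

Lemma rising_recl m w : rising m.+1 w = w * rising m (w + 1).
Proof.
rewrite /rising big_ord_recl addr0; congr (_ * _); apply: eq_bigr => j _.
by rewrite /= /bump add1n -addrA -natr1 [1 + _]addrC.
Qed.

Lemma risingS m w : rising m w * (w + m%:R) = w * rising m (w + 1).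
Proof.
by rewrite -rising_recl /rising big_ord_recr.
Qed.

Lemma rising_ge0 m w : 0 <= w -> 0 <= rising m w.
Proof. by move=> w_ge0; apply: prodr_ge0 => j _; rewrite addr_ge0. Qed.

Lemma rising_gt0 m w : 0 < w -> 0 < rising m w.
Proof. by move=> w_gt0; apply: prodr_gt0 => j _; rewrite ltr_wpDr. Qed.

Lemma rising_le m w w' : 0 <= w -> w <= w' -> rising m w <= rising m w'.
Proof. by move=> w_ge0 le_w; apply: ler_prod => j _; rewrite addr_ge0 ?lerD2r. Qed.

Lemma rising_nat m a : rising m a.+1%:R * a`!%:R = (a + m)`!%:R.
Proof.
elim: m => [|m IH]; first by rewrite /rising big_ord0 mul1r addn0.
rewrite /rising big_ord_recr -/(rising _ _) /= mulrAC IH -natrD -natrM.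
by rewrite addSn addnS factS mulnC.
Qed.

Definition ratfun n t : R :=
  rat_cst R n 70 * \prod_(j < (20 * n).+1) (4 * t + j%:R - (8 * n)%:R) /
    \prod_(l < n.+1) (t + l%:R) ^+ 70.

Lemma ratfunE n t : ratfun n t =
  rat_cst R n 70 * rising (20 * n).+1 (4 * t - (8 * n)%:R) / rising n.+1 t ^+ 70.
Proof.
rewrite /ratfun prodrXl /rising; congr (_ * _ / _).
by apply: eq_bigr => j _; rewrite addrAC.
Qed.

Lemma rat_cst_gt0 n : 0 < rat_cst R n 70.
Proof. by rewrite divr_gt0 // ltr0n ?part_gt0 // expn_gt0 fact_gt0. Qed.

Lemma ratfun_ge0 n t : 0 < t -> (8 * n)%:R <= 4 * t -> 0 <= ratfun n t.
Proof.
move=> t_gt0 le_t; rewrite ratfunE divr_ge0 //.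
  by rewrite mulr_ge0 ?(ltW (rat_cst_gt0 n)) // rising_ge0 // subr_ge0.
by rewrite exprn_ge0 // rising_ge0 // ltW.
Qed.

Lemma ratfun_gt0 n t : 0 < t -> (8 * n)%:R < 4 * t -> 0 < ratfun n t.
Proof.
move=> t_gt0 lt_t; rewrite ratfunE divr_gt0 //.
  by rewrite mulr_gt0 ?rat_cst_gt0 // rising_gt0 // subr_gt0.
by rewrite exprn_gt0 // rising_gt0.
Qed.

Lemma ratfun_eq0 n q t : (q <= 8 * n)%N -> 4 * t = q%:R -> ratfun n t = 0.
Proof.
move=> le_q Et; rewrite /ratfun.
have lt_j : (8 * n - q < (20 * n).+1)%N by lia.
rewrite (bigD1 (Ordinal lt_j)) //= Et natrB // [q%:R + _]addrC subrK subrr.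
by rewrite mul0r mulr0 mul0r.
Qed.

(* The arithmetic-geometric mean inequality applied to the values of [ratfun]
   half a step apart, whose logarithmic second difference is bounded below. *)
Lemma ratfun_half_step n t : 2 * n%:R + 1 <= t ->
  ratfun n (t + 2^-1) <= ratfun n t + ratfun n (t + 1).
Proof.
move=> t_ge; have n_ge0 : 0 <= n%:R :> R by [].
have t_gt0 : 0 < t by lra.
have R1 : 0 <= ratfun n t by apply: ratfun_ge0 => //; rewrite natrM; lra.
have R2 : 0 <= ratfun n (t + 1) by apply: ratfun_ge0; rewrite ?natrM; lra.
have R3 : 0 <= ratfun n (t + 2^-1) by apply: ratfun_ge0; rewrite ?natrM; lra.
suff sq : ratfun n (t + 2^-1) ^+ 2 <= 4 * (ratfun n t * ratfun n (t + 1)).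
  rewrite -(ler_pXn2r (_ : 0 < 2)%N) ?nnegrE ?addr_ge0 // (le_trans sq) //.
  rewrite -subr_ge0 [X in 0 <= X](_ : _ = (ratfun n t - ratfun n (t + 1)) ^+ 2) ?sqr_ge0 //.
  by ring.
rewrite !ratfunE; set c := rat_cst R n 70.
set w := 4 * t - (8 * n)%:R.
have w_ge4 : 4 <= w by rewrite /w natrM; lra.
have -> : 4 * (t + 2^-1) - (8 * n)%:R = w + 1 + 1 by rewrite /w; field.
have -> : 4 * (t + 1) - (8 * n)%:R = w + 1 + 1 + 1 + 1 by rewrite /w; ring.
set m := (20 * n).+1; set M : R := m%:R.
have M_ge0 : 0 <= M by [].
have num_le : rising m (w + 1 + 1) ^+ 2 <= 4 * (rising m w * rising m (w + 1 + 1 + 1 + 1)).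
  have E1 := risingS m w; have E2 := risingS m (w + 1).
  have E3 := risingS m (w + 1 + 1); have E4 := risingS m (w + 1 + 1 + 1).
  rewrite -/M in E1 E2 E3 E4.
  move: (rising m w) (rising m (w + 1)) (rising m (w + 1 + 1))
    (rising m (w + 1 + 1 + 1)) (rising m (w + 1 + 1 + 1 + 1)) E1 E2 E3 E4.
  move=> a b d e f E1 E2 E3 E4.
  have P1 : a * ((w + M) * (w + 1 + M)) = d * (w * (w + 1)).
    by rewrite mulrA E1 -mulrA E2; ring.
  have P2 : f * ((w + 2) * (w + 3)) = d * ((w + 2 + M) * (w + 3 + M)).
    transitivity ((w + 1 + 1) * (w + 1 + 1 + 1) * f); first by ring.
    by rewrite -mulrA -E4 mulrA -E3; ring.
  have Q_gt0 : 0 < (w + M) * (w + 1 + M) * ((w + 2) * (w + 3)).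
    by rewrite !mulr_gt0 //; lra.
  rewrite -(ler_pM2r Q_gt0).
  have -> : 4 * (a * f) * ((w + M) * (w + 1 + M) * ((w + 2) * (w + 3))) =
            4 * (a * ((w + M) * (w + 1 + M))) * (f * ((w + 2) * (w + 3))) by ring.
  rewrite P1 P2.
  have -> : 4 * (d * (w * (w + 1))) * (d * ((w + 2 + M) * (w + 3 + M))) =
            d ^+ 2 * ((w + 2 + M) * (w + 3 + M) * (4 * (w * (w + 1)))) by ring.
  have le1 : (w + M) * (w + 1 + M) <= (w + 2 + M) * (w + 3 + M).
    by apply: ler_pM; lra.
  (* The factor 4 of the mean inequality is spent here, where w >= 4. *)
  have le2 : (w + 2) * (w + 3) <= 4 * (w * (w + 1)) by nra.
  rewrite ler_wpM2l ?sqr_ge0 //; apply: ler_pM le1 le2; apply: mulr_ge0; lra.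
have den_le : rising n.+1 t * rising n.+1 (t + 1) <= rising n.+1 (t + 2^-1) ^+ 2.
  rewrite expr2 /rising -!big_split /=; apply: ler_prod => l _.
  have x_ge0 : 0 <= (l : nat)%:R :> R by [].
  move: ((l : nat)%:R : R) x_ge0 => x x_ge0; apply/andP; split; last by nra.
  by rewrite mulr_ge0 //; lra.
have V1 : 0 < rising n.+1 t by apply: rising_gt0.
have V2 : 0 < rising n.+1 (t + 1) by apply: rising_gt0; lra.
have V3 : 0 < rising n.+1 (t + 2^-1) by apply: rising_gt0; lra.
have c_gt0 : 0 < c := rat_cst_gt0 n.
have num0 : 0 <= rising m w * rising m (w + 1 + 1 + 1 + 1).
  by rewrite mulr_ge0 // rising_ge0 //; lra.
have -> : 4 * (c * rising m w / rising n.+1 t ^+ 70 *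
    (c * rising m (w + 1 + 1 + 1 + 1) / rising n.+1 (t + 1) ^+ 70)) =
    c ^+ 2 * (4 * (rising m w * rising m (w + 1 + 1 + 1 + 1))) /
    (rising n.+1 t * rising n.+1 (t + 1)) ^+ 70.
  rewrite [(rising n.+1 t * _) ^+ 70]exprMn.
  move: (rising n.+1 t ^+ 70) (rising n.+1 (t + 1) ^+ 70) (rising m w)
    (rising m (w + 1 + 1 + 1 + 1)) => a b d e.
  by rewrite invfM; ring.
rewrite expr_div_n exprMn.
rewrite -exprM mulnC exprM; apply: ler_pM.
- by rewrite mulr_ge0 ?sqr_ge0.
- by rewrite invr_ge0 exprn_ge0 ?sqr_ge0.
- by rewrite ler_wpM2l ?sqr_ge0.
rewrite lef_pV2 ?posrE ?exprn_gt0 ?mulr_gt0 //.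
by rewrite lerXn2r ?nnegrE ?mulr_ge0 ?sqr_ge0 // ltW.
Qed.

(** The half-integer next to the last zero 2 n is not covered by [ratfun_half_step]. Half a step
    multiplies the numerator by (20 n + 3)(20 n + 4) / 6 and the denominator by at most 2^70, so a
    large n suffices. *)
Lemma ratfun_first_half n : (0 < n)%N ->
  6 * 2 ^+ 70 <= (20 * n%:R + 3) * (20 * n%:R + 4) :> R ->
  ratfun n (2 * n%:R + 2^-1) <= ratfun n (2 * n%:R + 1).
Proof.
move=> n_gt0 n_large; have n_ge1 : 1 <= n%:R :> R by rewrite ler1n.
rewrite !ratfunE; set c := rat_cst R n 70; have c_gt0 : 0 < c := rat_cst_gt0 n.
have -> : 4 * (2 * n%:R + 2^-1) - (8 * n)%:R = 2 :> R by rewrite natrM; field.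
have -> : 4 * (2 * n%:R + 1) - (8 * n)%:R = 2 + 1 + 1 :> R by rewrite natrM; ring.
set m := (20 * n).+1.
have Em : m%:R = 20 * n%:R + 1 :> R by rewrite /m -[in LHS]natr1 natrM.
have E1 := risingS m (2 : R); have E2 := risingS m (2 + 1 : R).
have U0 : 0 < rising m (2 : R) by apply: rising_gt0.
have EU : 6 * rising m (2 + 1 + 1 : R) =
    rising m 2 * ((20 * n%:R + 3) * (20 * n%:R + 4)).
  have -> : 6 * rising m (2 + 1 + 1 : R) = 2 * ((2 + 1) * rising m (2 + 1 + 1)) by ring.
  by rewrite -E2 mulrA -E1 Em; ring.
have V0 : 0 < rising n.+1 (2 * n%:R : R) by apply: rising_gt0; lra.
have V1 : 0 < rising n.+1 (2 * n%:R + 1 : R) by apply: rising_gt0; lra.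
have V2 : 0 < rising n.+1 (2 * n%:R + 2^-1 : R) by apply: rising_gt0; lra.
have V1_le : rising n.+1 (2 * n%:R + 1 : R) <= 2 * rising n.+1 (2 * n%:R + 2^-1).
  apply: (@le_trans _ _ (2 * rising n.+1 (2 * n%:R))); last first.
    by rewrite ler_wpM2l // rising_le //; lra.
  have n2_gt0 : 0 < 2 * n%:R :> R by lra.
  rewrite -(ler_pM2l n2_gt0) -risingS -natr1 mulrC mulrCA mulrA ler_wpM2r ?(ltW V0) //.
  by lra.
rewrite -[c * _ / _]mulrA -[X in _ <= X]mulrA; apply: ler_wpM2l; first exact: ltW.
rewrite ler_pdivlMr ?exprn_gt0 // mulrAC ler_pdivrMr ?exprn_gt0 //.
apply: (@le_trans _ _ (rising m 2 * (2 ^+ 70 * rising n.+1 (2 * n%:R + 2^-1) ^+ 70))).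
  apply: ler_wpM2l; first exact: ltW.
  by rewrite -exprMn lerXn2r ?nnegrE ?mulr_ge0 // ltW.
rewrite mulrA; apply: ler_wpM2r; first by rewrite exprn_ge0 // ltW.
rewrite -(ler_pM2l (_ : 0 < 6)) // EU mulrCA.
by rewrite ler_wpM2l ?(ltW U0).
Qed.

Lemma bernoulli_ge (z : R) k : 0 <= z -> 1 + z *+ k <= (1 + z) ^+ k.
Proof.
move=> z_ge0; elim: k => [|k IH]; first by rewrite mulr0n addr0.
rewrite exprS mulrSr addrA; apply: le_trans (ler_wpM2l _ IH); last by lra.
have : 0 <= z *+ k by rewrite mulrn_wge0.
by move: (z *+ k) => zk zk_ge0; nra.
Qed.

(** Here v = t - 2 n, and the left-hand side bounds one of the four numerator ratios of a unit step.
    The base on the right is at least 31/21 for v <= n/10 and at least 27/20 for v <= 6n/7; beyond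
    that, Bernoulli's inequality is strong enough. *)
Lemma ratfun_sqr_decr_aux (nn v : R) : 10 <= nn -> nn / 84 <= v ->
  (4 * v + 20 * nn + 4) / (4 * v) <= ((3 * nn + v) / (2 * nn + v)) ^+ 17.
Proof.
move=> n_ge v_ge; have v_gt0 : 0 < v by lra.
have t_gt0 : 0 < 2 * nn + v by lra.
have -> : (4 * v + 20 * nn + 4) / (4 * v) = 1 + (5 * nn + 1) / v.
  by field; rewrite gt_eqF.
have base_ge (x : R) : 0 <= x -> x * (2 * nn + v) <= 3 * nn + v ->
    x ^+ 17 <= ((3 * nn + v) / (2 * nn + v)) ^+ 17.
  move=> x_ge0 x_le; rewrite lerXn2r ?nnegrE //; last by rewrite ler_pdivlMr.
  by rewrite divr_ge0 //; lra.
have quot_le (x : R) : 5 * nn + 1 <= x * v -> (5 * nn + 1) / v <= x.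
  by rewrite ler_pdivrMr.
have [v_small|v_large] := lerP v (nn / 10).
  apply: le_trans (base_ge (31 / 21) _ _); [|lra|lra].
  have := quot_le (429) _; lra.
have [v_small|v_large2] := lerP v (6 / 7 * nn).
  apply: le_trans (base_ge (27 / 20) _ _); [|lra|lra].
  have := quot_le 51 _; lra.
have bernoulli : 1 + nn / (2 * nn + v) *+ 17 <= ((3 * nn + v) / (2 * nn + v)) ^+ 17.
  have -> : (3 * nn + v) / (2 * nn + v) = 1 + nn / (2 * nn + v).
    by field; rewrite gt_eqF.
  by apply: bernoulli_ge; rewrite divr_ge0 //; lra.
apply: le_trans bernoulli; rewrite lerD2l ler_pdivrMr //.
have -> : nn / (2 * nn + v) *+ 17 * v = 17 * nn * v / (2 * nn + v).
  by rewrite -mulr_natr; ring.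
rewrite ler_pdivlMr //.
have h1 : 0 <= (v - 6 / 7 * nn) * nn by apply: mulr_ge0; lra.
have h2 : 0 <= (nn - 10) * nn by apply: mulr_ge0; lra.
have h3 : 0 <= (nn - 10) * v by apply: mulr_ge0; lra.
by nra.
Qed.
End Bounds.

(** * Decrease of R(t) t^2 *)

Section Decrease.
Variable R : realFieldType.
Implicit Types (w t v : R) (n m : nat).

Lemma rising_shift4 m w : 0 < w ->
  rising m (w + 4) * (w * (w + 1) * (w + 2) * (w + 3)) =
  rising m w * ((w + m%:R) * (w + 1 + m%:R) * (w + 2 + m%:R) * (w + 3 + m%:R)).
Proof.
move=> w_gt0; have E0 := risingS m w; have := risingS m (w + 1); have := risingS m (w + 2).
have := risingS m (w + 3).
have -> : w + 1 + 1 = w + 2 by ring.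
have -> : w + 2 + 1 = w + 3 by ring.
have -> : w + 3 + 1 = w + 4 by ring.
move=> E3 E2 E1; rewrite !mulrA E0.
transitivity (w * (rising m (w + 1) * (w + 1 + m%:R)) * (w + 2 + m%:R) * (w + 3 + m%:R)); last by ring.
rewrite E1.
transitivity (w * (w + 1) * (rising m (w + 2) * (w + 2 + m%:R)) * (w + 3 + m%:R)); last by ring.
rewrite E2.
transitivity (w * (w + 1) * (w + 2) * (rising m (w + 3) * (w + 3 + m%:R))); last by ring.
by rewrite E3; ring.
Qed.

(* Of the 70 factors (t + n + 1) / t gained in the denominator, 4 * 17 outweigh the growth
   of the numerator and 2 absorb the factor ((t + 1) / t) ^ 2. *)
Lemma ratfun_sqr_decr n t : (10 <= n)%N -> 2 * n%:R + n%:R / 84 <= t ->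
  ratfun n (t + 1) * (t + 1) ^+ 2 <= ratfun n t * t ^+ 2.
Proof.
move=> n_ge10 t_ge; have nn_ge10 : 10 <= n%:R :> R by rewrite ler_nat.
set v := t - 2 * n%:R; have v_ge : n%:R / 84 <= v by rewrite /v; lra.
have v_gt0 : 0 < v by lra.
have t_gt0 : 0 < t by rewrite /v in v_ge; lra.
rewrite !ratfunE; set c := rat_cst R n 70; have c_gt0 : 0 < c := rat_cst_gt0 R n.
set w := 4 * t - (8 * n)%:R.
have Ew : w = 4 * v by rewrite /w /v natrM; ring.
have w_gt0 : 0 < w by rewrite Ew; lra.
have -> : 4 * (t + 1) - (8 * n)%:R = w + 4 by rewrite /w; ring.
set m := (20 * n).+1; have Em : m%:R = 20 * n%:R + 1 :> R by rewrite /m -[in LHS]natr1 natrM.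
set q := ((3 * n%:R + v) / (2 * n%:R + v)).
have aux : (4 * v + 20 * n%:R + 4) / (4 * v) <= q ^+ 17 := ratfun_sqr_decr_aux nn_ge10 v_ge.
have num_le : rising m (w + 4) <= rising m w * q ^+ 68.
  have den_gt0 : 0 < w * (w + 1) * (w + 2) * (w + 3) by rewrite !mulr_gt0 //; lra.
  rewrite -(ler_pM2r den_gt0) rising_shift4 // -[_ * q ^+ 68 * _]mulrA.
  apply: ler_wpM2l; first by rewrite rising_ge0 // ltW.
  (* Each of the four ratios (w + i + m) / (w + i) is at most (w + 20 n + 4) / w. *)
  have fac_le i : 0 <= i -> i <= 3 -> 0 <= w + i + m%:R <= q ^+ 17 * (w + i).
    move=> i_ge0 i_le3; rewrite Em; apply/andP; split; first lra.
    rewrite -ler_pdivrMr; last lra.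
    apply: le_trans aux; rewrite -Ew ler_pdivrMr; last lra.
    rewrite mulrAC ler_pdivlMr //.
    by nra.
  have -> : q ^+ 68 * (w * (w + 1) * (w + 2) * (w + 3)) =
    (q ^+ 17 * (w + 0)) * (q ^+ 17 * (w + 1)) * (q ^+ 17 * (w + 2)) * (q ^+ 17 * (w + 3)).
    rewrite addr0 (exprM q 17 4); move: (q ^+ 17) => q17; ring.
  have /andP[f0 f0'] := fac_le 0 (lexx _) (ler0n _ 3); rewrite addr0 in f0 f0'.
  have /andP[f1 f1'] : 0 <= w + 1 + m%:R <= q ^+ 17 * (w + 1) by apply: fac_le; lra.
  have /andP[f2 f2'] : 0 <= w + 2 + m%:R <= q ^+ 17 * (w + 2) by apply: fac_le; lra.
  have /andP[f3 f3'] : 0 <= w + 3 + m%:R <= q ^+ 17 * (w + 3) by apply: fac_le; lra.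
  by rewrite addr0; do 3!(apply: ler_pM => //; rewrite ?mulr_ge0 //).
have V0 : 0 < rising n.+1 t by apply: rising_gt0.
have V1 : 0 < rising n.+1 (t + 1) by apply: rising_gt0; lra.
have den_le : (t + 1) ^+ 2 * q ^+ 68 / rising n.+1 (t + 1) ^+ 70 <=
              t ^+ 2 / rising n.+1 t ^+ 70.
  pose p := (t + n%:R + 1) / t.
  have q_ge0 : 0 <= q by rewrite /q divr_ge0 //; lra.
  have q_le : q <= p.
    have Et : 2 * n%:R + v = t by rewrite /v; ring.
    have Et3 : 3 * n%:R + v = t + n%:R by rewrite /v; ring.
    by rewrite /q /p Et Et3 ler_pM2r ?invr_gt0 //; lra.
  have p_gt0 : 0 < p by rewrite /p divr_gt0 //; lra.
  have pt : t + 1 <= p * t by rewrite /p divfK ?gt_eqF //; lra.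
  have -> : rising n.+1 (t + 1) = rising n.+1 t * p.
    have E := risingS n.+1 t; rewrite -natr1 addrA in E.
    by rewrite /p mulrA E mulrAC mulfV ?gt_eqF // mul1r.
  rewrite [(_ * p) ^+ 70]exprMn ler_pdivrMr; last by rewrite mulr_gt0 ?exprn_gt0.
  rewrite [X in _ <= X]mulrA divfK ?expf_neq0 ?gt_eqF //.
  rewrite (exprD p 2 68) [X in _ <= X]mulrA -[t ^+ 2 * _]exprMn [t * p]mulrC; apply: ler_pM.
  - by rewrite exprn_ge0 //; lra.
  - by rewrite exprn_ge0.
  - by apply: lerXn2r => //; rewrite nnegrE; lra.
  - by rewrite lerXn2r ?nnegrE // ltW.
apply: (@le_trans _ _ (c * rising m w * ((t + 1) ^+ 2 * q ^+ 68 / rising n.+1 (t + 1) ^+ 70))).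
  have -> : c * rising m w * ((t + 1) ^+ 2 * q ^+ 68 / rising n.+1 (t + 1) ^+ 70) =
     c * (rising m w * q ^+ 68) / rising n.+1 (t + 1) ^+ 70 * (t + 1) ^+ 2.
    by move: (q ^+ 68) (_ ^+ 70) => q68 D; ring.
  apply: ler_wpM2r; first by rewrite exprn_ge0 //; lra.
  apply: ler_wpM2r; first by rewrite invr_ge0 exprn_ge0 // ltW.
  by apply: ler_wpM2l num_le; apply: ltW.
rewrite -[X in _ <= X]mulrA [_^-1 * _]mulrC; apply: ler_wpM2l den_le.
by rewrite mulr_ge0 ?(ltW c_gt0) // rising_ge0 // ltW.
Qed.
End Decrease.

(** * Uniform bound in terms of the peak *)

Section PeakBound.
Variable R : realFieldType.
Implicit Types (n m y q d : nat).

Lemma sum_inv_sqr_le m : \sum_(q < m) (q.+1%:R ^+ 2)^-1 <= 2 :> R.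
Proof.
case: m => [|m]; first by rewrite big_ord0.
suff : \sum_(q < m.+1) (q.+1%:R ^+ 2)^-1 <= 2 - (m.+1%:R)^-1 :> R.
  by move/le_trans; apply; rewrite lerBlDr lerDl invr_ge0.
elim: m => [|m IH]; first by rewrite big_ord1 expr1n invr1; lra.
rewrite big_ord_recr /=; apply: le_trans (lerD IH (lexx _)) _.
rewrite -[m.+2%:R]natr1; have : 1 <= m.+1%:R :> R by rewrite ler1n.
move: (m.+1%:R : R) => z z_ge1; rewrite -subr_ge0.
have -> : 2 - (z + 1)^-1 - (2 - z^-1 + ((z + 1) ^+ 2)^-1) = (z * (z + 1) ^+ 2)^-1.
  by field; rewrite !gt_eqF //; lra.
by rewrite invr_ge0 mulr_ge0 ?exprn_ge0 //; lra.
Qed.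

(** A bound for R(t) when n = 42 y and 4 t = 8 n + w with 0 < w <= 2 y + 4. The numerator is taken
    at w = 2 y + 4, the denominator at t = 2 n without its first factor. *)
Definition peak y : R :=
  rat_cst R (42 * y) 70 * ((842 * y + 4)`!%:R / (2 * y + 3)`!%:R) *
  ((84 * y)`!%:R / (126 * y)`!%:R) ^+ 70.

Lemma peak_gt0 y : 0 < peak y.
Proof.
have fact_gt0R m : 0 < m`!%:R :> R by rewrite ltr0n fact_gt0.
apply: mulr_gt0; last by apply/exprn_gt0/divr_gt0.
by apply: mulr_gt0; [apply: rat_cst_gt0 | apply: divr_gt0].
Qed.

Lemma ratfun_peak y w (t : R) : (0 < y)%N -> (0 < w <= 2 * y + 4)%N ->
  4 * t = (8 * (42 * y) + w)%:R -> ratfun (42 * y) t <= peak y.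
Proof.
move=> y_gt0 /andP[w_gt0 w_le] Et; rewrite ratfunE /peak -[X in _ <= X]mulrA -mulrA.
have -> : 4 * t - (8 * (42 * y))%:R = w%:R by rewrite Et natrD addrC addKr.
have t_ge : (84 * y).+1%:R <= t + 1.
  rewrite -natr1 lerD2r -(ler_pM2l (_ : 0 < 4 :> R)) // Et -natrM ler_nat; lia.
have t_ge1 : 1 <= t.
  by apply: le_trans (_ : (84 * y)%:R <= _); [rewrite ler1n; lia|rewrite -natr1 lerD2r in t_ge].
apply: ler_wpM2l; first exact/ltW/rat_cst_gt0.
apply: ler_pM.
- exact: rising_ge0.
- by rewrite invr_ge0 exprn_ge0 // rising_ge0 // (le_trans _ t_ge1).
- rewrite ler_pdivlMr ?ltr0n ?fact_gt0 //.
  apply: (@le_trans _ _ (rising (20 * (42 * y)).+1 (2 * y + 3).+1%:R * (2 * y + 3)`!%:R)).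
    by apply: ler_wpM2r => //; apply: rising_le => //; rewrite ler_nat; lia.
  by rewrite rising_nat ler_nat; apply/eq_leq; congr (_`!); lia.
rewrite -exprVn lerXn2r ?nnegrE ?invr_ge0 ?divr_ge0 //.
  by rewrite rising_ge0 // (le_trans _ t_ge1).
rewrite -[X in _ <= X]invf_div lef_pV2 ?posrE ?divr_gt0 ?ltr0n ?fact_gt0 //; last first.
  by rewrite rising_gt0 // (lt_le_trans _ t_ge1).
rewrite ler_pdivrMr ?ltr0n ?fact_gt0 //.
apply: (@le_trans _ _ (rising (42 * y) (84 * y).+1%:R * (84 * y)`!%:R)).
  by rewrite rising_nat ler_nat; apply/eq_leq; congr (_`!); lia.
apply: ler_wpM2r => //; rewrite rising_recl.
apply: le_trans (rising_le _ _ t_ge) _ => //; rewrite ler_peMl // rising_ge0 //.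
by rewrite addr_ge0 // (le_trans _ t_ge1).
Qed.

Lemma peak_bound_ge0 y : 0 <= 9 * (42 * y)%:R ^+ 2 * peak y.
Proof.
apply: mulr_ge0; last exact/ltW/peak_gt0.
by apply: mulr_ge0 => //; apply: exprn_ge0.
Qed.

(** From w = 2 y on, that is t = 2 n + n/84, unit steps decrease R(t) t^2, so t can be lowered into
    the window w <= 2 y + 4. There [peak] bounds R(t), and t <= 3 n gives 9 n^2. *)
Lemma ratfun_sqr_bound y q (t : R) : (0 < y)%N -> (0 < q)%N -> 4 * t = q%:R ->
  ratfun (42 * y) t * t ^+ 2 <= 9 * (42 * y)%:R ^+ 2 * peak y.
Proof.
move=> y_gt0 q_gt0 Et; have rhs_ge0 := peak_bound_ge0 y.
have [q_le|q_gt] := leqP q (8 * (42 * y)).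
  by rewrite (ratfun_eq0 q_le Et) mul0r.
have [w Ew] : exists w, q = (8 * (42 * y) + w.+1)%N.
  by exists (q - 8 * (42 * y)).-1; lia.
move: Et; rewrite Ew => Et {q q_gt0 q_gt Ew}.
elim/ltn_ind: w t Et => w IH t Et.
have [w_le|w_gt] := leqP w.+1 (2 * y + 4).
  have t_gt0 : 0 < t by rewrite -(pmulr_rgt0 _ (_ : 0 < 4 :> R)) // Et ltr0n; lia.
  have t_le : t <= 3 * (42 * y)%:R.
    by rewrite -(ler_pM2l (_ : 0 < 4 :> R)) // Et -!natrM ler_nat; lia.
  rewrite mulrC; apply: ler_pM.
  - exact/exprn_ge0/ltW.
  - by apply/ltW/ratfun_gt0 => //; rewrite Et ltr_nat; lia.
  - have -> : 9 * (42 * y)%:R ^+ 2 = (3 * (42 * y)%:R) ^+ 2 :> R by ring.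
    have t_ge0 := ltW t_gt0; have r_ge0 := le_trans t_ge0 t_le.
    by apply: lerXn2r (t_le); rewrite nnegrE.
  - by apply: (ratfun_peak y_gt0 _ Et); rewrite w_le.
have Et' : 4 * (t - 1) = (8 * (42 * y) + (w - 4).+1)%:R.
  rewrite mulrBr Et mulr1 -natrB; first by congr (_%:R); lia.
  lia.
have lt_w : (w - 4 < w)%N by lia.
apply: le_trans (IH _ lt_w _ Et'); rewrite -{1 2}[t](subrK 1).
apply: ratfun_sqr_decr; first lia.
rewrite -(ler_pM2l (_ : 0 < 4 :> R)) // Et'.
have -> : 4 * (2 * (42 * y)%:R + (42 * y)%:R / 84) = (8 * (42 * y) + 2 * y)%:R :> R.
  by rewrite natrD !natrM; field.
rewrite ler_nat; lia.
Qed.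

(** Bounding R(q/d) by B d^2 / q^2 costs d^2 <= 16, the inverse squares sum to at most 2, and 9 * 16
    * 2 = 288. *)
Lemma sum_ratfun_le y d m : (0 < y)%N -> (0 < d)%N -> (d %| 4)%N ->
  \sum_(q < m) ratfun (42 * y) (q.+1%:R / d%:R) <=
  288 * (42 * y)%:R ^+ 2 * peak y.
Proof.
move=> y_gt0 d_gt0 d4; set B := 9 * (42 * y)%:R ^+ 2 * peak y.
have B_ge0 : 0 <= B := peak_bound_ge0 y.
have d_neq0 : d%:R != 0 :> R by rewrite pnatr_eq0 -lt0n.
have term q : ratfun (42 * y) (q.+1%:R / d%:R) <= 16 * B * (q.+1%:R ^+ 2)^-1.
  have [k Ek] := dvdnP d4; have k_gt0 : (0 < k)%N by case: (k) Ek.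
  have Et : 4 * (q.+1%:R / d%:R) = (k * q.+1)%:R :> R.
    by rewrite -[4]/(4%:R) Ek !natrM; field.
  have kq_gt0 : (0 < k * q.+1)%N by rewrite muln_gt0 k_gt0.
  have := ratfun_sqr_bound y_gt0 kq_gt0 Et.
  have t_gt0 : 0 < q.+1%:R / d%:R :> R by rewrite divr_gt0 // ltr0n.
  rewrite -/B -ler_pdivlMr ?exprn_gt0 // => /le_trans; apply.
  rewrite expr_div_n invf_div mulrA; apply: ler_wpM2r; first by rewrite invr_ge0 exprn_ge0.
  rewrite [16 * B]mulrC; apply: ler_wpM2l => //; rewrite -natrX (ler_nat _ _ 16).
  by rewrite (leq_sqr d 4) dvdn_leq.
apply: le_trans (ler_sum _ (fun (q : 'I_m) _ => term q)) _.
rewrite -mulr_sumr; apply: le_trans (ler_wpM2l _ (sum_inv_sqr_le m)) _.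
  by rewrite mulr_ge0.
by rewrite /B; move: (peak y) (_ ^+ 2) => b c; lra.
Qed.
End PeakBound.

(** * Partial sums and denominators of the rational parts *)

Section LinearForms.
Variable R : realFieldType.
Implicit Types (n k d i M : nat).

Definition harmonic_sum i M : R := \sum_(q < M) (q.+1%:R ^+ i)^-1.

Lemma harmonic_sum_shift i a M :
  \sum_(q < M) ((q.+1 + a)%:R ^+ i)^-1 = harmonic_sum i (M + a) - harmonic_sum i a :> R.
Proof.
rewrite /harmonic_sum [(M + a)%N]addnC big_split_ord /= [RHS]addrC addKr.
by apply: eq_bigr => q _; rewrite addnC addnS.
Qed.

Lemma sum_ratfun_expand n d M : (0 < n)%N -> (0 < d)%N ->
  \sum_(q < d * M) ratfun n (q.+1%:R / d%:R : R) =
  \sum_(k < n.+1) \sum_(i < 70) pf_coef R n 70 k i.+1 * d%:R ^+ i.+1 *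
    (harmonic_sum i.+1 (d * M + d * k) - harmonic_sum i.+1 (d * k)).
Proof.
move=> n_gt0 d_gt0; have d_neq0 : d%:R != 0 :> R by rewrite pnatr_eq0 -lt0n.
transitivity (\sum_(q < d * M) \sum_(k < n.+1) \sum_(i < 70)
    pf_coef R n 70 k i.+1 * d%:R ^+ i.+1 * ((q.+1 + d * k)%:R ^+ i.+1)^-1).
  apply: eq_bigr => q _; rewrite /ratfun pf_expansion; first last.
  - by move=> l _; rewrite gt_eqF // ltr_wpDr // divr_gt0 // ltr0n.
  - by lia.
  apply: eq_bigr => k _; apply: eq_bigr => i _.
  rewrite -[RHS]mulrA; congr (_ * _).
  have -> : q.+1%:R / d%:R + k%:R = (q.+1 + d * k)%:R / d%:R :> R.
    by rewrite natrD natrM mulrDl mulrAC divff // mul1r.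
  by rewrite expr_div_n invf_div.
rewrite exchange_big /=; apply: eq_bigr => k _.
rewrite exchange_big /=; apply: eq_bigr => i _.
by rewrite -mulr_sumr harmonic_sum_shift.
Qed.

(** All orders i are summed together, so that the zero of the numerator at e/4 - k can act through
    [local_poly_root]. Term by term, powers of e could remain in the denominator. *)
Lemma pf_value_int (Z : subringClosed R) n k e : (0 < n)%N -> (k <= n)%N ->
  (0 < e <= 4 * k)%N ->
  (slcm n (20 * n))%:R ^+ 70 *
    \sum_(i < 70) pf_coef R n 70 k i.+1 * (4 / e%:R) ^+ i.+1 \in Z.
Proof.
move=> n_gt0 le_kn e_bnd; set L := (slcm _ _)%:R.
suff -> : L ^+ 70 * \sum_(i < 70) pf_coef R n 70 k i.+1 * (4 / e%:R) ^+ i.+1 =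
  \sum_(m < 70) (local_poly R n 70 k)`_m * (4 * L / e%:R) ^+ (70 - m).
  exact: local_poly_root.
rewrite mulr_sumr [RHS](reindex_inj rev_ord_inj) /=; apply: eq_bigr => i _.
have lt_i : (i.+1 <= 70)%N by [].
rewrite subKn // /pf_coef -/L.
have -> : 4 * L / e%:R = L * (4 / e%:R) by ring.
have L_neq0 : L != 0 := L_neq0 R n.
rewrite [(L * _) ^+ _]exprMn; move: (_`__) ((4 / e%:R) ^+ i.+1) => p z.
have -> : L ^+ 70 = L ^+ (70 - i.+1) * L ^+ i.+1 by rewrite -exprD subnK.
rewrite exprVn; have : L ^+ (70 - i.+1) != 0 by rewrite expf_neq0.
move: (L ^+ (70 - i.+1)) (L ^+ i.+1) => a b a_neq0.
by field.
Qed.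

(** With 4 = c d, the point q/d becomes c q / 4 where c q <= 4 k, so [pf_value_int] applies to each
    q. *)
Lemma rational_part_int (Z : subringClosed R) n d : (0 < n)%N -> (0 < d)%N -> (d %| 4)%N ->
  (slcm n (20 * n))%:R ^+ 70 * \sum_(k < n.+1) \sum_(i < 70)
    pf_coef R n 70 k i.+1 * d%:R ^+ i.+1 * harmonic_sum i.+1 (d * k) \in Z.
Proof.
move=> n_gt0 d_gt0 /dvdnP[c Ec]; rewrite mulr_sumr; apply: rpred_sum => k _.
have c_gt0 : (0 < c)%N by case: c Ec.
have d_neq0 : d%:R != 0 :> R by rewrite pnatr_eq0 -lt0n.
have le_kn : (k <= n)%N by rewrite -ltnS.
have -> : \sum_(i < 70) pf_coef R n 70 k i.+1 * d%:R ^+ i.+1 * harmonic_sum i.+1 (d * k) =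
  \sum_(q < d * k) \sum_(i < 70) pf_coef R n 70 k i.+1 * (4 / (c * q.+1)%:R) ^+ i.+1.
  rewrite exchange_big /=; apply: eq_bigr => i _; rewrite mulr_sumr.
  apply: eq_bigr => q _; rewrite -mulrA -exprVn -exprMn; congr (_ * _ ^+ _).
  rewrite -[4]/(4%:R) Ec !natrM invfM mulrACA divff ?mul1r //.
  by rewrite pnatr_eq0 -lt0n.
rewrite mulr_sumr; apply: rpred_sum => q _; apply: pf_value_int => //.
rewrite muln_gt0 c_gt0 /= -[4%N]/(4%N) Ec -mulnA leq_mul2l.
by rewrite (ltn_ord q) orbT.
Qed.
End LinearForms.

(** * Positivity of the combination *)

Section Combination.
Variable R : realFieldType.
Implicit Types (n d M q : nat).

Lemma ratfun_quarter_ge0 n q (t : R) : (0 < q)%N -> 4 * t = q%:R -> 0 <= ratfun n t.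
Proof.
move=> q_gt0 Et; have [le_q|lt_q] := leqP q (8 * n); first by rewrite (ratfun_eq0 le_q Et).
apply/ltW/ratfun_gt0; last by rewrite Et ltr_nat.
by rewrite -(pmulr_rgt0 _ (_ : 0 < 4)) // Et ltr0n.
Qed.

Lemma sum_even_odd M (f : nat -> R) :
  \sum_(q < 2 * M) f q = \sum_(a < M) f (2 * a)%N + \sum_(a < M) f (2 * a).+1.
Proof.
elim: M => [|M IH]; first by rewrite !big_ord0 addr0.
have -> : (2 * M.+1 = (2 * M).+2)%N by rewrite mulnS.
by rewrite !big_ord_recr /= IH; ring.
Qed.

Definition shifted_sum n d M : R := \sum_(q < d * M) ratfun n (q.+1%:R / d%:R).

Variable n : nat.
Hypothesis n_gt0 : (0 < n)%N.
Hypothesis n_large : 6 * 2 ^+ 70 <= (20 * n%:R + 3) * (20 * n%:R + 4) :> R.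

(** Below 2 n the left-hand side is zero, at 2 n + 1/2 the special estimate applies, and beyond that
    the mean inequality. *)
Lemma ratfun_half_le a : ratfun n (a.+1%:R + 2^-1 : R) <= ratfun n a.+1%:R + ratfun n a.+2%:R.
Proof.
have R_ge0 b : 0 <= ratfun n (b.+1%:R : R).
  by apply: (@ratfun_quarter_ge0 _ (4 * b.+1)); rewrite ?natrM.
have [lt_a|le_a] := ltnP a.+1 (2 * n).
  rewrite (@ratfun_eq0 _ _ (4 * a.+1 + 2)) ?addr_ge0 //; first lia.
  by rewrite natrD natrM; field.
have [le_n|lt_n] := leqP a.+1 (2 * n).
  have Ea : a.+1%:R = 2 * n%:R :> R by rewrite -natrM; congr (_%:R); lia.
  rewrite -[a.+2%:R]natr1 Ea; apply: le_trans (ratfun_first_half n_gt0 n_large) _.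
  by rewrite lerDr -Ea.
rewrite -[a.+2%:R]natr1; apply: ratfun_half_step.
by rewrite -natrM natr1 ler_nat.
Qed.

(** Each integral value bounds its two half-integral neighbours. The last one is used only once;
    subtracting it makes the induction work. *)
Lemma half_sum_le M :
  \sum_(a < M) ratfun n (a%:R + 2^-1 : R) <= 2 * \sum_(a < M) ratfun n a.+1%:R.
Proof.
have R_ge0 b : 0 <= ratfun n (b.+1%:R : R).
  by apply: (@ratfun_quarter_ge0 _ (4 * b.+1)); rewrite ?natrM.
case: M => [|M]; first by rewrite !big_ord0 mulr0.
suff : \sum_(a < M.+1) ratfun n (a%:R + 2^-1 : R) <=
       2 * \sum_(a < M.+1) ratfun n a.+1%:R - ratfun n M.+1%:R.
  by move/le_trans; apply; rewrite lerBlDr lerDl.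
elim: M => [|M IH].
  rewrite !big_ord1 (@ratfun_eq0 _ _ 2); [by have := R_ge0 0%N; lra|lia|by rewrite /= add0r; field].
rewrite big_ord_recr [X in 2 * X]big_ord_recr /=.
have := ratfun_half_le M; lra.
Qed.

Lemma shifted_sum2 M : shifted_sum n 2 M =
  \sum_(a < M) ratfun n (a%:R + 2^-1) + \sum_(a < M) ratfun n a.+1%:R.
Proof.
rewrite /shifted_sum (sum_even_odd M (fun q => ratfun n (q.+1%:R / 2%:R))).
congr (_ + _); apply: eq_bigr => a _; congr (ratfun n _).
  by rewrite -natr1 natrM; field.
have -> : (2 * a).+2 = (2 * a.+1)%N by rewrite mulnS.
by rewrite natrM; field.
Qed.

Lemma shifted_sum1 M : shifted_sum n 1 M = \sum_(a < M) ratfun n a.+1%:R.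
Proof. by rewrite /shifted_sum mul1n; apply: eq_bigr => a _; rewrite divr1. Qed.

Lemma shifted_sum_ge0 d M : (0 < d)%N -> (d %| 4)%N -> 0 <= shifted_sum n d M.
Proof.
move=> d_gt0 /dvdnP[k Ek]; apply: sumr_ge0 => q _.
have d_neq0 : d%:R != 0 :> R by rewrite pnatr_eq0 -lt0n.
apply: (@ratfun_quarter_ge0 _ (k * q.+1)); first by case: k Ek.
by rewrite -[4]/(4%:R) Ek !natrM; field.
Qed.

Lemma shifted_sum4_ge M : shifted_sum n 2 M <= shifted_sum n 4 M.
Proof.
rewrite /shifted_sum.
have -> : (4 * M = 2 * (2 * M))%N by lia.
rewrite (sum_even_odd _ (fun q => ratfun n (q.+1%:R / 4%:R))) -[X in X <= _]add0r.
apply: lerD.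
  apply: sumr_ge0 => a _; apply: (@ratfun_quarter_ge0 _ (2 * a).+1) => //.
  by field.
apply: ler_sum => a _; rewrite le_eqVlt; apply/orP; left; apply/eqP; congr (ratfun n _).
have -> : (2 * a).+2 = (2 * a.+1)%N by rewrite mulnS.
by rewrite natrM; field.
Qed.

(* The weights are the coefficients of (X - 8)(X - c). *)
Lemma combination_ge (c : R) M : 32 <= c -> (2 * n < M)%N ->
  ratfun n (2 * n).+1%:R <=
    8 * c * shifted_sum n 1 M - (8 + c) * shifted_sum n 2 M + shifted_sum n 4 M.
Proof.
move=> c_ge lt_M; have := shifted_sum4_ge M; have := half_sum_le M.
rewrite shifted_sum1 shifted_sum2.
have R_ge0 b : 0 <= ratfun n (b.+1%:R : R).
  by apply: (@ratfun_quarter_ge0 _ (4 * b.+1)); rewrite ?natrM.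
have : ratfun n (2 * n).+1%:R <= \sum_(a < M) ratfun n (a.+1%:R : R).
  rewrite (bigD1 (Ordinal lt_M)) //= lerDl sumr_ge0 // => i _.
have : 0 <= ratfun n ((2 * n).+1%:R : R) by [].
move: (ratfun n _) (\sum_(a < M) ratfun n (a%:R + 2^-1)) (\sum_(a < M) _) (shifted_sum n 4 M).
move=> r H I S r_ge0 r_le H_le S_ge.
(* From S >= H + I and H <= 2 I the combination is at least (5 c - 21) I, hence at least I. *)
have h1 : 0 <= (7 + c) * (2 * I - H) by apply: mulr_ge0; lra.
have h2 : 0 <= (c - 32) * I by apply: mulr_ge0; lra.
by nra.
Qed.

Lemma combination_le (c b : R) M : 0 <= c ->
  shifted_sum n 1 M <= b -> shifted_sum n 4 M <= b ->
  8 * c * shifted_sum n 1 M - (8 + c) * shifted_sum n 2 M + shifted_sum n 4 M <=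
    (8 * c + 1) * b.
Proof.
move=> c_ge0 le1 le4; have S2 : 0 <= shifted_sum n 2 M by apply: shifted_sum_ge0.
move: (shifted_sum n 1 M) (shifted_sum n 2 M) (shifted_sum n 4 M) le1 le4 S2 => x z w *.
have h1 : 0 <= (8 + c) * z by apply: mulr_ge0; lra.
have h2 : 0 <= c * (b - x) by apply: mulr_ge0; lra.
by nra.
Qed.
End Combination.

(** * Linear forms in zeta values *)

Local Open Scope classical_set_scope.

(** * Passage to the limit *)

Section Limits.
Variable R : realType.
Implicit Types (i d k M : nat).

Lemma cvg_sumr (I : Type) (r : seq I) (f : I -> nat -> R) (l : I -> R) :
  (forall j, f j @ \oo --> l j) ->
  (fun M => \sum_(j <- r) f j M) @ \oo --> \sum_(j <- r) l j.
Proof. by move=> f_cvg; apply: cvg_big => //; exact: add_continuous. Qed.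

Lemma harmonic_sum_le2 i M : (2 <= i)%N -> harmonic_sum R i M <= 2.
Proof.
move=> i_ge2; apply: le_trans (sum_inv_sqr_le R M); apply: ler_sum => q _.
by rewrite lef_pV2 ?posrE ?exprn_gt0 ?ltr0n // ler_weXn2l // ler1n.
Qed.

Lemma harmonic_sum_cvg i : (2 <= i)%N -> harmonic_sum R i @ \oo --> zeta (i%:R : R).
Proof.
move=> i_ge2.
have Es : series (fun k : nat => k.+1%:R `^ (- i%:R)) = harmonic_sum R i.
  apply/funext => M; rewrite /series /= big_mkord; apply: eq_bigr => q _.
  by rewrite powR_invn.
rewrite /zeta Es; apply: nondecreasing_is_cvgn.
  apply/nondecreasing_seqP => M; rewrite /harmonic_sum big_ord_recr /= lerDl.
  by rewrite invr_ge0 exprn_ge0.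
by exists 2 => _ [M _ <-]; apply: harmonic_sum_le2.
Qed.

Lemma cvg_affine_index (d a : nat) (u : nat -> R) (l : R) : (0 < d)%N ->
  u @ \oo --> l -> (fun M : nat => u (d * M + a)%N) @ \oo --> l.
Proof.
move=> d_gt0 ul; apply: (cvg_comp (fun M => d * M + a)%N u _ ul).
apply/cvgnyPge => A; near=> M.
have : (A <= M)%N by near: M; apply: nbhs_infty_ge.
nia.
Unshelve. all: by end_near.
Qed.

Lemma harmonic_sum1_diff_cvg d a : (0 < d)%N ->
  (fun M : nat => harmonic_sum R 1 (d * M + a) - harmonic_sum R 1 (d * M)) @ \oo --> (0 : R).
Proof.
move=> d_gt0.
have -> : (fun M : nat => harmonic_sum R 1 (d * M + a) - harmonic_sum R 1 (d * M)) =
    (fun M : nat => \sum_(q < a) (d * M + q)%N.+1%:R^-1).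
  apply/funext => M; rewrite /harmonic_sum big_split_ord /= [LHS]addrC addKr.
  by apply: eq_bigr => q _; rewrite expr1.
have : (fun M : nat => \sum_(q < a) (d * M + q)%N.+1%:R^-1) @ \oo --> (\sum_(q < a) 0 : R).
  apply: cvg_sumr => q.
  exact: (@cvg_affine_index d q (@harmonic R) 0 d_gt0 (@cvg_harmonic R)).
by rewrite big1.
Qed.

(* The divergent value zeta 1 never contributes, since its coefficient vanishes. *)
Definition zeta_reg i : R := if i == 1%N then 0 else zeta i%:R.

Lemma shifted_sum_cvg n d : (0 < n)%N -> (0 < d)%N ->
  shifted_sum R n d @ \oo -->
  (\sum_(k < n.+1) \sum_(i < 70) pf_coef R n 70 k i.+1 * d%:R ^+ i.+1 *
    (zeta_reg i.+1 - harmonic_sum R i.+1 (d * k))).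
Proof.
move=> n_gt0 d_gt0.
(* The divergent sums of order one are renormalised by the harmonic sum up to d M. The total change
   is zero because the residues sum to zero. *)
pose corr i M := if i == 0%N then harmonic_sum R 1 (d * M) else 0.
have -> : shifted_sum R n d = (fun M => \sum_(k < n.+1) \sum_(i < 70)
    pf_coef R n 70 k i.+1 * d%:R ^+ i.+1 *
      (harmonic_sum R i.+1 (d * M + d * k) - corr i M - harmonic_sum R i.+1 (d * k))).
  apply/funext => M; rewrite /shifted_sum sum_ratfun_expand //; apply/eqP.
  rewrite -subr_eq0 -sumrB; apply/eqP.
  transitivity (\sum_(k < n.+1) pf_coef R n 70 k 1 * (d%:R * harmonic_sum R 1 (d * M))).
    apply: eq_bigr => k _; rewrite -sumrB big_ord_recl big1 => [|i _].
      by rewrite /corr /= addr0 expr1; ring.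
    by rewrite /corr /=; ring.
  by rewrite -mulr_suml pf_coef_residue ?mul0r //; lia.
apply: cvg_sumr => k; apply: cvg_sumr => i; apply: cvgM; first exact: cvg_cst.
apply: cvgB; last exact: cvg_cst.
rewrite /zeta_reg /corr; case: i => -[|i] lt_i /=; first exact: harmonic_sum1_diff_cvg.
under eq_fun do rewrite subr0.
exact/cvg_affine_index/harmonic_sum_cvg.
Qed.
End Limits.

(** * Integrality of the combined limit *)

Section Irrationality.
Variable R : realType.
Implicit Types (i d k M : nat).

Definition limit_form n d : R :=
  \sum_(k < n.+1) \sum_(i < 70) pf_coef R n 70 k i.+1 * d%:R ^+ i.+1 *
    (zeta_reg R i.+1 - harmonic_sum R i.+1 (d * k)).

Lemma limit_formE n d : limit_form n d =
  \sum_(i < 70) (\sum_(k < n.+1) pf_coef R n 70 k i.+1) * d%:R ^+ i.+1 * zeta_reg R i.+1 -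
  \sum_(k < n.+1) \sum_(i < 70)
    pf_coef R n 70 k i.+1 * d%:R ^+ i.+1 * harmonic_sum R i.+1 (d * k).
Proof.
under [in RHS]eq_bigr => i _ do rewrite 2!mulr_suml.
rewrite exchange_big /= -sumrB; apply: eq_bigr => k _.
by rewrite -sumrB; apply: eq_bigr => i _; rewrite mulrBr.
Qed.

(** As d^i runs through 1, 2^i, 4^i, zeta(i) acquires the factor (2^i - 8)(2^i - 2^m), which
    vanishes for i = 3 and i = m. Even i drop out by symmetry, and A clears the remaining values. *)
Lemma combination_int n m (A : nat) : (0 < n)%N ->
  (forall j, odd j -> (5 <= j <= 69)%N -> j != m -> A%:R * zeta (j%:R : R) \is a Num.int) ->
  (slcm n (20 * n))%:R ^+ 70 * A%:R *
    (8 * 2 ^+ m * limit_form n 1 - (8 + 2 ^+ m) * limit_form n 2 + limit_form n 4)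
    \is a Num.int.
Proof.
move=> n_gt0 A_int; rewrite !limit_formE; set L := (slcm _ _)%:R.
pose rat d := \sum_(k < n.+1) \sum_(i < 70)
    pf_coef R n 70 k i.+1 * d%:R ^+ i.+1 * harmonic_sum R i.+1 (d * k).
pose rho i : R := \sum_(k < n.+1) pf_coef R n 70 k i.
have rat_int d : (0 < d)%N -> (d %| 4)%N -> L ^+ 70 * rat d \is a Num.int.
  by move=> d_gt0 d4; apply: (@rational_part_int R _).
have -> : L ^+ 70 * A%:R * (8 * 2 ^+ m *
     (\sum_(i < 70) rho i.+1 * 1%:R ^+ i.+1 * zeta_reg R i.+1 - rat 1%N) -
     (8 + 2 ^+ m) * (\sum_(i < 70) rho i.+1 * 2%:R ^+ i.+1 * zeta_reg R i.+1 - rat 2%N) +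
     (\sum_(i < 70) rho i.+1 * 4%:R ^+ i.+1 * zeta_reg R i.+1 - rat 4%N)) =
  \sum_(i < 70) L ^+ 70 * rho i.+1 * (A%:R * zeta_reg R i.+1) *
     ((2 ^+ i.+1 - 8) * (2 ^+ i.+1 - 2 ^+ m)) -
  A%:R * (8 * 2 ^+ m * (L ^+ 70 * rat 1%N) - (8 + 2 ^+ m) * (L ^+ 70 * rat 2%N) +
    L ^+ 70 * rat 4%N).
  have -> : \sum_(i < 70) L ^+ 70 * rho i.+1 * (A%:R * zeta_reg R i.+1) *
     ((2 ^+ i.+1 - 8) * (2 ^+ i.+1 - 2 ^+ m)) =
     L ^+ 70 * A%:R * (8 * 2 ^+ m * (\sum_(i < 70) rho i.+1 * 1%:R ^+ i.+1 * zeta_reg R i.+1) -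
     (8 + 2 ^+ m) * (\sum_(i < 70) rho i.+1 * 2%:R ^+ i.+1 * zeta_reg R i.+1) +
     (\sum_(i < 70) rho i.+1 * 4%:R ^+ i.+1 * zeta_reg R i.+1)).
    rewrite !mulr_sumr -sumrB -big_split /= mulr_sumr; apply: eq_bigr => i _.
    have -> : 4%:R ^+ i.+1 = 2 ^+ i.+1 * 2 ^+ i.+1 :> R by rewrite -exprMn; congr (_ ^+ _); ring.
    rewrite expr1n; move: (L ^+ 70) (rho _) (zeta_reg _ _) (2 ^+ i.+1) (2 ^+ m) => l r z u c.
    by ring.
  move: (L ^+ 70) (\sum_(i < 70) _) (\sum_(i < 70) _) (\sum_(i < 70) _) (2 ^+ m)
    (rat _) (rat _) (rat _) => l s1 s2 s4 c r1 r2 r4.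
  by ring.
have pow_int k : 2 ^+ k \is a (@Num.int R) by rewrite rpredX ?rpred_nat.
have nat_int k : k%:R \is a (@Num.int R) by rewrite rpred_nat.
apply: rpredB; last first.
  apply: rpredM => //; apply: rpredD; last exact: rat_int.
  apply: rpredB; apply: rpredM; rewrite ?rat_int //.
    by apply: rpredM => //; apply: nat_int.
  by apply: rpredD => //; apply: nat_int.
apply: rpred_sum => i _; set j := i.+1.
have [j1|j_neq1] := eqVneq j 1%N.
  by rewrite /zeta_reg j1 eqxx mulr0 mulr0 mul0r rpred0.
have [j_odd|j_even] := boolP (odd j); last first.
  by rewrite /rho (pf_coef_even R n) ?mulr0 ?mul0r ?rpred0 //; have := ltn_ord i.
have [jm|j_neqm] := eqVneq j m.
  by rewrite jm subrr mulr0 mulr0 rpred0.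
have [j3|j_neq3] := eqVneq j 3%N.
  rewrite j3 (_ : 2 ^+ 3 - 8 = 0) ?mul0r ?mulr0 ?rpred0 //.
  by ring.
have j_bnd : (5 <= j <= 69)%N.
  have j70 : (j <= 70)%N := ltn_ord i.
  move: j_odd j_neq1 j_neq3 j70; case: (j) => [|[|[|[|[|j']]]]] // j'_odd _ _ j'_le.
  have neq70 : j'.+4.+1 != 70%N by apply: contraTneq j'_odd => ->.
  by lia.
apply: rpredM; last by apply: rpredM; apply: rpredB => //; apply: nat_int.
apply: rpredM.
  rewrite /rho mulr_sumr; apply: rpred_sum => k _.
  apply: (@pf_coef_int R _); first by rewrite -ltnS.
  exact: ltn_ord i.
by rewrite /zeta_reg (negbTE j_neq1) A_int.
Qed.
End Irrationality.

(** * The contradiction and the final case distinction *)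

Section Main.
Variable R : realType.

(** The bounds on partial sums pass to the limit. Positivity stays strict because the lower bound is
    the fixed positive value at 2 n + 1. *)
Lemma limit_form_bounds y m : (0 < y)%N -> (5 <= m)%N ->
  6 * 2 ^+ 70 <= (20 * (42 * y)%:R + 3) * (20 * (42 * y)%:R + 4) :> R ->
  let l := 8 * 2 ^+ m * limit_form R (42 * y) 1 - (8 + 2 ^+ m) * limit_form R (42 * y) 2
           + limit_form R (42 * y) 4 in
  0 < l /\ l <= (8 * 2 ^+ m + 1) * (288 * (42 * y)%:R ^+ 2 * peak R y).
Proof.
move=> y_gt0 m_ge5 n_large l; set n := (42 * y)%N in n_large l *.
have n_gt0 : (0 < n)%N by rewrite muln_gt0.
have c_ge : 32 <= 2 ^+ m :> R.
  by rewrite (_ : 32 = 2 ^+ 5) ?ler_weXn2l ?ler1n //; ring.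
pose f M := 8 * 2 ^+ m * shifted_sum R n 1 M - (8 + 2 ^+ m) * shifted_sum R n 2 M
            + shifted_sum R n 4 M.
have f_cvg : f @ \oo --> l.
  by apply: cvgD; [apply: cvgB|]; rewrite /limit_form;
     do ?[apply: cvgM; first exact: cvg_cst]; apply: shifted_sum_cvg.
split.
  apply: (@lt_le_trans _ _ (ratfun n ((2 * n).+1%:R : R))).
    by apply: ratfun_gt0; rewrite // -?natrM ?ltr_nat; lia.
  apply: (cvgr_to_ge f_cvg); exists (2 * n).+1 => // M /= lt_M.
  exact: combination_ge.
apply: (cvgr_to_le f_cvg); exists 0%N => // M _.
by apply: combination_le; rewrite ?exprn_ge0 //; apply: sum_ratfun_le.
Qed.

Lemma peak_small y D :
  (D * ((42 * y) ^ 2 * (slcm (42 * y) (840 * y) ^ 70 *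
    ((42 * y)`! * (84 * y)`!) ^ 70 * (842 * y + 4)`!)) <
  (840 * y)`!`_(smooth (42 * y)) * (2 * y + 3)`! * (126 * y)`! ^ 70)%N ->
  (slcm (42 * y) (20 * (42 * y)))%:R ^+ 70 * (D%:R * ((42 * y)%:R ^+ 2 * peak R y)) < 1.
Proof.
have E840 : (20 * (42 * y) = 840 * y)%N by lia.
rewrite /peak /rat_cst E840.
set P := (((840 * y)`!)`_(smooth (42 * y)))%N; have : (0 < P)%N by apply: part_gt0.
have := fact_gt0 (2 * y + 3); have := fact_gt0 (126 * y).
move: (slcm _ _) P (42 * y)`! (84 * y)`! (842 * y + 4)`! (2 * y + 3)`! (126 * y)`!.
move=> L P a b e f g g_gt0 f_gt0 P_gt0.
rewrite [((a * b) ^ _)%N]expnMn expr_div_n -!natrX.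
have : (0 < g ^ 70)%N by rewrite expn_gt0 g_gt0.
move: (g ^ 70)%N (a ^ 70)%N (b ^ 70)%N (L ^ 70)%N ((42 * y) ^ 2)%N => G A B L' n2 G_gt0.
rewrite -(ltr_nat R) !natrM => lt1.
have P0 : 0 < P%:R :> R by rewrite ltr0n.
have f0 : 0 < f%:R :> R by rewrite ltr0n.
have G0 : 0 < G%:R :> R by rewrite ltr0n.
have den_gt0 : 0 < P%:R * f%:R * G%:R :> R by rewrite mulr_gt0 // mulr_gt0.
rewrite -(ltr_pM2r den_gt0) mul1r; apply: le_lt_trans lt1.
rewrite le_eqVlt; apply/orP; left; apply/eqP.
by field; rewrite !gt_eqF.
Qed.

Lemma common_denominator (s : seq nat) :
  (forall j, j \in s -> rational (zeta (j%:R : R))) ->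
  exists2 A : nat, (0 < A)%N & forall j, j \in s -> A%:R * zeta (j%:R : R) \is a Num.int.
Proof.
elim: s => [|i s IH] rat_s; first by exists 1%N.
have [|A A_gt0 A_int] := IH; first by move=> j js; apply: rat_s; rewrite inE js orbT.
have [q _ Eq] := rat_s i (mem_head _ _).
exists (A * `|denq q|)%N; first by rewrite muln_gt0 A_gt0 absz_gt0 denq_neq0.
move=> j; rewrite inE => /orP[/eqP ->|js].
  rewrite natrM -mulrA rpredM ?rpred_nat // -Eq natr_absz gtr0_norm ?denq_gt0 //.
  rewrite -{2}(divq_num_den q) fmorph_div /= !ratr_int mulrC divfK ?rpred_int //.
  by rewrite intr_eq0 denq_neq0.
by rewrite natrM mulrAC rpredM ?rpred_nat // A_int.
Qed.

Lemma odd_zeta_irrational_except (m : nat) : (5 <= m <= 69)%N ->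
  ~ (forall j, odd j -> (5 <= j <= 69)%N -> j != m -> rational (zeta (j%:R : R))).
Proof.
case/andP=> m_ge m_le rat_zeta.
pose s := [seq j <- iota 5 65 | odd j && (j != m)].
have [|A A_gt0 A_int] := @common_denominator s.
  move=> j; rewrite mem_filter mem_iota => /andP[/andP[j_odd j_neq] j_bnd].
  by apply: rat_zeta => //; lia.
(* The first argument collects A and the constants of the upper bound in [limit_form_bounds]; the
   second makes y large enough for [n_large]. *)
have [y [le_Ky y_gt0 small]] := small_multiplier (A * ((8 * 2 ^ m + 1) * 288))
  (Num.bound (6 * 2 ^+ 70 : R)).
have n_large : 6 * 2 ^+ 70 <= (20 * (42 * y)%:R + 3) * (20 * (42 * y)%:R + 4) :> R.
  have : 6 * 2 ^+ 70 <= y%:R :> R.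
    apply: le_trans (ltW (archi_boundP _)) _; first by rewrite mulr_ge0 ?exprn_ge0.
    by rewrite ler_nat.
  move: (6 * 2 ^+ 70) => k k_le; rewrite natrM.
  have : 0 <= y%:R :> R by [].
  by move: (y%:R : R) k_le => z k_le z_ge0; nra.
have [l_gt0 l_le] := limit_form_bounds y_gt0 m_ge n_large.
set l := (X in 0 < X) in l_gt0 l_le.
have n_gt0 : (0 < 42 * y)%N by rewrite muln_gt0.
have := @combination_int R (42 * y) m A n_gt0 _; rewrite -/l.
have A_int' j : odd j -> (5 <= j <= 69)%N -> j != m -> A%:R * zeta (j%:R : R) \is a Num.int.
  by move=> j_odd j_bnd j_neq; apply: A_int; rewrite mem_filter mem_iota j_odd j_neq; lia.
move/(_ A_int'); set L := (slcm _ _)%:R => X_int.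
have L_gt0 : 0 < L ^+ 70 by rewrite exprn_gt0 // ltr0n slcm_gt0.
have X_gt0 : 0 < L ^+ 70 * A%:R * l by apply: mulr_gt0 => //; apply: mulr_gt0 => //; rewrite ltr0n.
(* A positive integer is at least 1, against the upper bound from [peak_small]. *)
have := norm_intr_ge1 X_int (lt0r_neq0 X_gt0); rewrite gtr0_norm //.
apply/negP; rewrite -ltNge; apply: le_lt_trans (peak_small small); rewrite -/L.
rewrite -mulrA ler_pM2l //; apply: le_trans (ler_wpM2l _ l_le) _ => //.
rewrite !natrM natrD natrM natrX -!natrM.
by rewrite le_eqVlt; apply/orP; left; apply/eqP; move: (peak R y) (_ ^+ 2) (2 ^+ m) => p z c; ring.
Qed.
End Main.

Theorem theorem1 (R : realType) :
  exists m n : nat,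
    [/\ odd m, odd n, (5 <= m)%N, (m < n)%N & (n <= 69)%N] /\
    irrational (zeta (m%:R : R)) /\ irrational (zeta (n%:R : R)).
Proof.
apply: contrapT => no_pair.
(* If the value at i is irrational, the choice m = i forces a second irrational value; if there is
   none, m = 5 already gives a contradiction. *)
have [[i [i_odd i_bnd i_irr]]|none] := pselect (exists i : nat,
    [/\ odd i, (5 <= i <= 69)%N & irrational (zeta (i%:R : R))]).
  apply: (@odd_zeta_irrational_except R i i_bnd) => j j_odd j_bnd j_neq.
  apply: contrapT => j_irr; apply: no_pair.
  have [lt_ij|lt_ji|eq_ij] := ltngtP i j; last by rewrite eq_ij eqxx in j_neq.
    by exists i, j; split=> //; split=> //; lia.
  by exists j, i; split=> //; split=> //; lia.
apply: (@odd_zeta_irrational_except R 5) => // j j_odd j_bnd _.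
by apply: contrapT => j_irr; apply: none; exists j.
Qed.
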